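(* Let $\tilde p:\mathbb{D}\to\mathbb{C}$ be a holomorphic function with $\operatorname{Re}\tilde p\ge0$, and for $k\in\mathbb{R}$ let $\{\psi_t\}_{t\ge 0}$ be the semigroup of holomorphic self-maps of $\mathbb{D}$ defined by $$\frac{d}{dt}\psi_t(z)=(\psi_t(z)-1)^2\,\tilde p(\psi_t(z))-ik\,\psi_t(z),\qquad \psi_0(z)=z,\quad z\in\mathbb{D},\ t\ge 0.$$ Then there exists $k_0$ such that for all $k\in\mathbb{R}$ with $|k|>k_0$ the semigroup $\{\psi_t\}_{t\ge0}$ is elliptic. Moreover, the Denjoy-Wolff point of the semigroup is arbitrarily close to $0$ provided $k_0$ is large enough: for every $\delta>0$ one can choose $k_0$ so that for all $|k|>k_0$ the semigroup is elliptic with Denjoy-Wolff point $z_0$ satisfying $|z_0|<\delta$.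
   Context: $\mathbb{D}$ is the open unit disk. The vector field $f(z)=(z-1)^2\tilde p(z)-ikz$ generates a one-parameter continuous semigroup of holomorphic self-maps of $\mathbb{D}$. If $f\not\equiv0$, it has a unique Berkson-Porta representation $f(z)=(z-\tau_0)(\overline{\tau_0}z-1)p_0(z)$ with $\tau_0\in\overline{\mathbb{D}}$ and $p_0$ holomorphic in $\mathbb{D}$, $\operatorname{Re}p_0\ge0$; the point $\tau_0$ is called the Denjoy-Wolff point of the semigroup. The semigroup is called elliptic if $\tau_0\in\mathbb{D}$; equivalently, if $f$ has a zero in $\mathbb{D}$ (which is then $\tau_0$, the common fixed point of all $\psi_t$). *)

(* Defs.v *)
From Stdlib Require Import Reals.
From Coquelicot Require Import Coquelicot.

Open Scope C_scope.

Definition in_disk (z : C) : Prop := (Cmod z < 1)%R.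

(* Functions on the disk are total maps C -> C whose values outside the disk
   are never used.  The scalar field is C, so this is complex
   differentiability. *)
Definition holomorphic_on_disk (f : C -> C) : Prop :=
  forall z, in_disk z -> ex_derive (K := C_AbsRing) (V := C_NormedModule) f z.

(* [psi t] is only meaningful for t >= 0.  Only pointwise continuity at
   time 0 is required. *)
Record holomorphic_semigroup (psi : R -> C -> C) : Prop := {
  semigroup_self_map :
    forall t z, (0 <= t)%R -> in_disk z -> in_disk (psi t z);
  semigroup_holomorphic :
    forall t, (0 <= t)%R -> holomorphic_on_disk (psi t);
  semigroup_0 :
    forall z, in_disk z -> psi 0%R z = z;
  semigroup_add :
    forall s t z, (0 <= s)%R -> (0 <= t)%R -> in_disk z ->
      psi (s + t)%R z = psi s (psi t z);
  semigroup_continuous :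
    forall z, in_disk z ->
      filterlim (fun t => psi t z) (at_right 0) (locally z)
}.

(* d/dt psi_t(z) = f(psi_t(z)) for t >= 0.  The derivative is the real one in
   t, relative to [0, +oo): two-sided for t > 0 and one-sided at t = 0. *)
Definition generated_by (psi : R -> C -> C) (f : C -> C) : Prop :=
  forall t z, (0 <= t)%R -> in_disk z ->
    filterdiff (K := R_AbsRing) (U := R_NormedModule) (V := C_R_NormedModule)
      (fun s : R => psi s z)
      (within (fun s : R => (0 <= s)%R) (locally t))
      (fun h : R => RtoC h * f (psi t z)).

Definition berkson_porta (f : C -> C) (tau : C) (p0 : C -> C) : Prop :=
  (Cmod tau <= 1)%R /\
  holomorphic_on_disk p0 /\
  (forall z, in_disk z -> (0 <= Re (p0 z))%R) /\
  (forall z, in_disk z -> f z = (z - tau) * (Cconj tau * z - 1) * p0 z).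

(* The nonvanishing clause is what makes tau unique: for f = 0 every tau would
   qualify, with p0 = 0. *)
Definition is_Denjoy_Wolff_point (psi : R -> C -> C) (tau : C) : Prop :=
  exists f : C -> C,
    generated_by psi f /\
    (exists z, in_disk z /\ f z <> 0) /\
    (exists p0 : C -> C, berkson_porta f tau p0).

Definition elliptic (psi : R -> C -> C) : Prop :=
  exists tau, is_Denjoy_Wolff_point psi tau /\ in_disk tau.

Definition rotated_field (p : C -> C) (k : R) (z : C) : C :=
  (z - 1) ^ 2 * p z - Ci * RtoC k * z.

(* Main.v *)
Require Import Defs.
From Stdlib Require Import Reals Lra Lia ClassicalEpsilon.
From Coquelicot Require Import Coquelicot.

(* The semigroup plays no role beyond its generator f.  For |k| large, f(z) = 0
   reads z = (z-1)^2 p(z) / (ik), whose right-hand side is a contraction of a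
   small disc about 0 since p is Lipschitz there; this gives the zero tau.
   The quotient p0 = f / ((z - tau)(conj tau z - 1)) is holomorphic after
   removing the singularity at tau.  Re p0 >= 0 is first shown with p(rz),
   r < 1, in place of p: everything is then holomorphic across the unit
   circle, where (z-1)^2 = -z|z-1|^2 and
   (z - tau)(conj tau z - 1) = -z|z - tau|^2 give
   Re p0 = |z-1|^2 Re p(rz) / |z - tau|^2 >= 0, and Poisson's formula carries
   this inside; then r -> 1.  As only complex differentiability is assumed,
   the regularity needed comes from Goursat's bisection applied to a homotopy
   of circles, which gives Cauchy's formula. *)

Open Scope R_scope.

(** * Complex-valued paths and their integrals *)

(** A Denjoy-Wolff point is certified by exhibiting [p0], so a small zero of the generator does not
    suffice: the sign of Re [p0] has to be established on the whole disc, although [p] may have no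
    boundary values. Dilating the argument of [p] alone, and not the whole field, keeps both circle
    identities exact. The price is that the zero moves with r. The same contraction controls this
    motion: its ratio 1/2 is uniform for r in [0, 1], so the zeros for r tend to the zero for r = 1.
    Positivity goes through the limit in the form Re (f conj D) >= 0 with D = (z - tau)(conj tau z -
    1), which involves no division; division by |D|^2 comes last, and the point z = tau, where D
    vanishes, is recovered by continuity. The singularity at tau requires a Taylor expansion of
    order two, because the quotient must be differentiable there and not merely bounded. Poisson's
    formula arises by adding to Cauchy's formula a second Cauchy integral whose value is zero. *)

Lemma dyadic_limit (x : nat -> R) :
  (forall n, x (S n) = x n \/ x (S n) = x n + (/ 2) ^ S n) ->
  exists X, forall n, x n <= X <= x n + (/ 2) ^ n.
Proof.
intros H.
assert (Hp : forall n, 0 < (/ 2) ^ n) by (intros n; apply pow_lt; lra).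
assert (Hi : forall n, x n <= x (S n)).
{ intros n. specialize (Hp (S n)). destruct (H n); lra. }
assert (Hd : forall n, x (S n) + (/ 2) ^ S n <= x n + (/ 2) ^ n).
{ intros n. specialize (Hp n). destruct (H n) as [E|E]; rewrite E; simpl; lra. }
assert (Hb : forall n, x n + (/ 2) ^ n <= x 0%nat + 1).
{ induction n; [simpl; lra|]. specialize (Hd n). lra. }
destruct (ex_finite_lim_seq_incr x (x 0%nat + 1) Hi) as [X HX].
{ intros n. specialize (Hb n). specialize (Hp n). lra. }
exists X. intros n. split.
- now apply is_lim_seq_incr_compare.
- apply (is_lim_seq_decr_compare (fun n => x n + (/ 2) ^ n)); trivial.
  replace (Finite X) with (Finite (X + 0)) by (f_equal; ring).
  apply is_lim_seq_plus'; trivial.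
  apply is_lim_seq_geom. rewrite Rabs_pos_eq; lra.
Qed.

(** Here [P x y h] is meant for the square with lower left corner (x, y) and side h. If [P] failed
    on the unit square it would fail on a quarter, then on a quarter of that one, and so on; the
    failing squares shrink to a point (X, Y), where the local hypothesis contradicts them. *)
Lemma square_bisection (P : R -> R -> R -> Prop) :
  (forall x y h, 0 < h ->
     P x y (h / 2) -> P (x + h / 2) y (h / 2) ->
     P x (y + h / 2) (h / 2) -> P (x + h / 2) (y + h / 2) (h / 2) -> P x y h) ->
  (forall X Y, 0 <= X <= 1 -> 0 <= Y <= 1 -> exists delta, 0 < delta /\
     forall x y h, 0 < h < delta -> x <= X <= x + h -> y <= Y <= y + h -> P x y h) ->
  P 0 0 1.
Proof.
intros Hsub Hloc. apply NNPP. intros Hn.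
assert (Hstep : forall q : R * R * R, exists q' : R * R,
  let '(x, y, h) := q in 0 < h -> ~ P x y h ->
    ~ P (fst q') (snd q') (h / 2) /\
    (fst q' = x \/ fst q' = x + h / 2) /\ (snd q' = y \/ snd q' = y + h / 2)).
{ intros [[x y] h].
  destruct (classic (P x y (h / 2))) as [H1|H1]; [|exists (x, y); simpl; tauto].
  destruct (classic (P (x + h / 2) y (h / 2))) as [H2|H2];
    [|exists (x + h / 2, y); simpl; tauto].
  destruct (classic (P x (y + h / 2) (h / 2))) as [H3|H3];
    [|exists (x, y + h / 2); simpl; tauto].
  destruct (classic (P (x + h / 2) (y + h / 2) (h / 2))) as [H4|H4];
    [|exists (x + h / 2, y + h / 2); simpl; tauto].
  (* All four quarters are good here, so the square is good and [~ P x y h] is refuted; the witness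
     is arbitrary. *)
  exists (x, y). intros H0 H5. elim H5. now apply Hsub. }
set (step := fun q => proj1_sig (constructive_indefinite_description _ (Hstep q))).
set (u := fix u n := match n with O => (0, 0)
  | S m => step (fst (u m), snd (u m), (/ 2) ^ m) end).
assert (Hp : forall n, 0 < (/ 2) ^ n) by (intros n; apply pow_lt; lra).
assert (Hh : forall n, (/ 2) ^ n / 2 = (/ 2) ^ S n) by (intros n; simpl; field).
assert (Hu : forall n, ~ P (fst (u n)) (snd (u n)) ((/ 2) ^ n) ->
  ~ P (fst (u (S n))) (snd (u (S n))) ((/ 2) ^ S n) /\
  (fst (u (S n)) = fst (u n) \/ fst (u (S n)) = fst (u n) + (/ 2) ^ S n) /\
  (snd (u (S n)) = snd (u n) \/ snd (u (S n)) = snd (u n) + (/ 2) ^ S n)).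
{ intros n HP. rewrite <- Hh. simpl u. unfold step at 1 2 3 4 5 6.
  destruct (constructive_indefinite_description _ _) as [q' Hq]. simpl.
  apply Hq; trivial. }
assert (HnP : forall n, ~ P (fst (u n)) (snd (u n)) ((/ 2) ^ n)).
{ induction n; [exact Hn|]. now apply Hu. }
destruct (dyadic_limit (fun n => fst (u n))) as [X HX].
{ intros n. apply (Hu n (HnP n)). }
destruct (dyadic_limit (fun n => snd (u n))) as [Y HY].
{ intros n. apply (Hu n (HnP n)). }
destruct (Hloc X Y) as [d [Hd0 Hd]].
{ specialize (HX 0%nat). simpl in HX. lra. }
{ specialize (HY 0%nat). simpl in HY. lra. }
destruct (pow_lt_1_zero (/ 2)) with (y := d) as [N HN]; trivial.
{ rewrite Rabs_pos_eq; lra. }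
apply (HnP N). apply Hd; trivial. split; trivial.
specialize (HN N (le_n N)). rewrite Rabs_pos_eq in HN; trivial. now left.
Qed.

Open Scope C_scope.

Definition C_diff (f : C -> C) (z l : C) : Prop :=
  forall eps : R, (0 < eps)%R -> exists delta : R, (0 < delta)%R /\
    forall y, (Cmod (y - z) < delta)%R ->
      (Cmod (f y - f z - l * (y - z)) <= eps * Cmod (y - z))%R.

Lemma C_diff_of_ex_derive f z :
  ex_derive (K := C_AbsRing) (V := C_NormedModule) f z -> exists l, C_diff f z l.
Proof.
intros [l [_ H]]. exists l. intros eps He.
specialize (H z (fun P HP => HP) (mkposreal eps He)).
destruct H as [d Hd]. exists d. split. apply cond_pos.
intros y Hy. specialize (Hd y Hy).
change (Cmod (f y - f z - (y - z) * l) <= eps * Cmod (y - z))%R in Hd.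
now rewrite (Cmult_comm l).
Qed.

Lemma ex_derive_of_C_diff f z l :
  C_diff f z l -> ex_derive (K := C_AbsRing) (V := C_NormedModule) f z.
Proof.
intros H. exists l. split.
- apply is_linear_scal_l.
- intros x Hx eps.
  rewrite <- (is_filter_lim_locally_unique _ _ Hx).
  destruct (H eps (cond_pos eps)) as [d [Hd0 Hd]].
  exists (mkposreal d Hd0). intros y Hy.
  change (Cmod (f y - f z - (y - z) * l) <= eps * Cmod (y - z))%R.
  rewrite (Cmult_comm _ l). apply Hd. exact Hy.
Qed.

Lemma Cmod_sub_sym (x y : C) : Cmod (x - y) = Cmod (y - x).
Proof. rewrite <- Cmod_opp. f_equal. ring. Qed.

Lemma Cmod_le_Re_Im (z : C) : (Cmod z <= Rabs (Re z) + Rabs (Im z))%R.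
Proof.
replace z with (RtoC (Re z) + Ci * RtoC (Im z)) at 1.
- eapply Rle_trans; [apply Cmod_triangle|].
  rewrite Cmod_mult, Cmod_Ci, !Cmod_R. lra.
- destruct z as [x y]. unfold Cplus, Cmult, Ci, RtoC. simpl. f_equal; ring.
Qed.

(** Taken componentwise so that real integrability and the real fundamental theorem of calculus
    apply. [is_RInt_CInt] and [CInt_unique] identify it with the integral in C as a real normed
    space, from which additivity and the norm bound are read off. *)
Definition CInt (f : R -> C) (a b : R) : C :=
  (RInt (fun t => Re (f t)) a b, RInt (fun t => Im (f t)) a b).

Definition path_continuous (f : R -> C) (t : R) : Prop :=
  continuous (fun s => Re (f s)) t /\ continuous (fun s => Im (f s)) t.

Definition path_derive (f : R -> C) (t : R) (l : C) : Prop :=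
  is_derive (fun s => Re (f s)) t (Re l) /\ is_derive (fun s => Im (f s)) t (Im l).

Lemma path_derive_continuous f t l : path_derive f t l -> path_continuous f t.
Proof.
intros [H1 H2]; split; apply (ex_derive_continuous (V := R_NormedModule));
eexists; eassumption.
Qed.

Lemma path_continuous_const c t : path_continuous (fun _ => c) t.
Proof. split; apply continuous_const. Qed.

Lemma path_continuous_plus f g t :
  path_continuous f t -> path_continuous g t ->
  path_continuous (fun s => f s + g s) t.
Proof.
intros [H1 H2] [H3 H4]; split; simpl;
apply (continuous_plus (V := R_NormedModule)); assumption.
Qed.

Lemma path_continuous_opp f t :
  path_continuous f t -> path_continuous (fun s => - f s) t.
Proof.
intros [H1 H2]; split; simpl; apply (continuous_opp (V := R_NormedModule)); assumption.
Qed.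

Lemma path_continuous_mult f g t :
  path_continuous f t -> path_continuous g t ->
  path_continuous (fun s => f s * g s) t.
Proof.
intros [H1 H2] [H3 H4]; split; simpl.
- apply (continuous_minus (V := R_NormedModule));
  apply (continuous_mult (K := R_AbsRing)); assumption.
- apply (continuous_plus (V := R_NormedModule));
  apply (continuous_mult (K := R_AbsRing)); assumption.
Qed.

Lemma path_continuous_eps f t :
  (forall eps : R, (0 < eps)%R -> exists delta : R, (0 < delta)%R /\
    forall s, (Rabs (s - t) < delta)%R -> (Cmod (f s - f t) < eps)%R) ->
  path_continuous f t.
Proof.
intros H; split; apply filterlim_locally; intros eps;
destruct (H eps (cond_pos eps)) as [d [Hd0 Hd]];
exists (mkposreal d Hd0); intros s Hs; specialize (Hd s Hs);
pose proof (Rmax_Cmod (f s - f t)) as Hm;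
(eapply Rle_lt_trans; [|exact Hd]);
(eapply Rle_trans; [|exact Hm]).
- apply Rmax_l.
- apply Rmax_r.
Qed.

Lemma eps_of_path_continuous f t : path_continuous f t ->
  forall eps : R, (0 < eps)%R -> exists delta : R, (0 < delta)%R /\
    forall s, (Rabs (s - t) < delta)%R -> (Cmod (f s - f t) < eps)%R.
Proof.
intros [H1 H2] eps He.
assert (He2 : (0 < eps / 2)%R) by lra.
apply filterlim_locally with (eps := mkposreal _ He2) in H1.
apply filterlim_locally with (eps := mkposreal _ He2) in H2.
destruct H1 as [d1 H1]. destruct H2 as [d2 H2].
exists (Rmin d1 d2). split. apply Rmin_pos; apply cond_pos.
intros s Hs.
assert (Ha : (Rabs (Re (f s - f t)) < eps / 2)%R).
{ apply H1. eapply Rlt_le_trans; [exact Hs|apply Rmin_l]. }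
assert (Hb : (Rabs (Im (f s - f t)) < eps / 2)%R).
{ apply H2. eapply Rlt_le_trans; [exact Hs|apply Rmin_r]. }
apply Rsqr_incrst_0; [|apply Cmod_ge_0|lra].
unfold Rsqr.
replace (Cmod (f s - f t) * Cmod (f s - f t))%R with (Cmod (f s - f t) ^ 2)%R by ring.
rewrite Cmod2_alt.
apply Rabs_def2 in Ha. apply Rabs_def2 in Hb.
set (x := Re (f s - f t)) in *. set (y := Im (f s - f t)) in *. nra.
Qed.

Lemma path_continuous_comp g l f t :
  C_diff g (f t) l -> path_continuous f t -> path_continuous (fun s => g (f s)) t.
Proof.
intros Hg Hf. apply path_continuous_eps. intros eps He.
destruct (Hg 1%R Rlt_0_1) as [d [Hd0 Hd]].
pose proof (Cmod_ge_0 l) as Hl.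
assert (He' : (0 < Rmin d (eps / (Cmod l + 2)))%R).
{ apply Rmin_pos; trivial. apply Rdiv_lt_0_compat; lra. }
destruct (eps_of_path_continuous _ _ Hf _ He') as [d' [Hd0' Hd']].
exists d'. split; trivial. intros s Hs. specialize (Hd' s Hs).
assert (H1 : (Cmod (f s - f t) < d)%R) by (eapply Rlt_le_trans; [exact Hd'|apply Rmin_l]).
assert (H2 : (Cmod (f s - f t) < eps / (Cmod l + 2))%R)
  by (eapply Rlt_le_trans; [exact Hd'|apply Rmin_r]).
specialize (Hd _ H1).
replace (g (f s) - g (f t)) with
  ((g (f s) - g (f t) - l * (f s - f t)) + l * (f s - f t)) by ring.
eapply Rle_lt_trans; [apply Cmod_triangle|].
rewrite Cmod_mult.
apply Rle_lt_trans with ((Cmod l + 2) * Cmod (f s - f t))%R.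
{ pose proof (Cmod_ge_0 (f s - f t)). nra. }
apply Rlt_le_trans with ((Cmod l + 2) * (eps / (Cmod l + 2)))%R.
{ apply Rmult_lt_compat_l; lra. }
right. field. lra.
Qed.

Lemma is_RInt_CInt f a b : (a <= b)%R ->
  (forall t, (a <= t <= b)%R -> path_continuous f t) ->
  is_RInt (V := C_R_NormedModule) f a b (CInt f a b).
Proof.
intros Hab H. unfold CInt.
apply (is_RInt_fct_extend_pair (U := R_NormedModule) (V := R_NormedModule));
apply (RInt_correct (V := R_CompleteNormedModule));
apply (ex_RInt_continuous (V := R_CompleteNormedModule));
rewrite Rmin_left, Rmax_right by trivial;
intros t Ht; apply (H t Ht).
Qed.

Lemma CInt_unique f a b l : is_RInt (V := C_R_NormedModule) f a b l -> CInt f a b = l.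
Proof.
intros H. unfold CInt. destruct l as [l1 l2]. f_equal; apply is_RInt_unique.
- apply (is_RInt_fct_extend_fst (U := R_NormedModule) (V := R_NormedModule) f _ _ _ H).
- apply (is_RInt_fct_extend_snd (U := R_NormedModule) (V := R_NormedModule) f _ _ _ H).
Qed.

Lemma Cmod_CInt_le f a b M : (a <= b)%R ->
  (forall t, (a <= t <= b)%R -> path_continuous f t) ->
  (forall t, (a <= t <= b)%R -> Cmod (f t) <= M)%R ->
  (Cmod (CInt f a b) <= (b - a) * M)%R.
Proof.
intros Hab Hc HM. rewrite Cmod_norm.
apply (norm_RInt_le_const (V := C_R_NormedModule) f a b); trivial.
- intros t Ht. rewrite <- Cmod_norm. now apply HM.
- now apply is_RInt_CInt.
Qed.

Lemma CInt_ext f g a b : (a <= b)%R ->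
  (forall t, (a <= t <= b)%R -> f t = g t) -> CInt f a b = CInt g a b.
Proof.
intros Hab H. unfold CInt. f_equal; apply RInt_ext;
rewrite Rmin_left, Rmax_right by trivial; intros t Ht; rewrite H; trivial; lra.
Qed.

Lemma CInt_minus f g a b : (a <= b)%R ->
  (forall t, (a <= t <= b)%R -> path_continuous f t) ->
  (forall t, (a <= t <= b)%R -> path_continuous g t) ->
  CInt (fun t => f t - g t) a b = CInt f a b - CInt g a b.
Proof.
intros Hab Hf Hg. apply CInt_unique.
apply (is_RInt_minus (V := C_R_NormedModule) f g); now apply is_RInt_CInt.
Qed.

Lemma CInt_plus f g a b : (a <= b)%R ->
  (forall t, (a <= t <= b)%R -> path_continuous f t) ->
  (forall t, (a <= t <= b)%R -> path_continuous g t) ->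
  CInt (fun t => f t + g t) a b = CInt f a b + CInt g a b.
Proof.
intros Hab Hf Hg. apply CInt_unique.
apply (is_RInt_plus (V := C_R_NormedModule) f g); now apply is_RInt_CInt.
Qed.

Lemma CInt_Chasles f a b c : (a <= b)%R -> (b <= c)%R ->
  (forall t, (a <= t <= c)%R -> path_continuous f t) ->
  CInt f a c = CInt f a b + CInt f b c.
Proof.
intros Hab Hbc H. apply CInt_unique.
apply (is_RInt_Chasles (V := C_R_NormedModule) f a b c);
apply is_RInt_CInt; trivial; intros t Ht; apply H; lra.
Qed.

Lemma CInt_derive f df a b : (a <= b)%R ->
  (forall t, (a <= t <= b)%R -> path_derive f t (df t)) ->
  (forall t, (a <= t <= b)%R -> path_continuous df t) ->
  CInt df a b = f b - f a.
Proof.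
intros Hab Hd Hc. unfold CInt.
assert (H1 : RInt (fun t => Re (df t)) a b = (Re (f b) - Re (f a))%R).
{ apply is_RInt_unique.
  apply (is_RInt_derive (V := R_CompleteNormedModule) (fun t => Re (f t)));
  rewrite Rmin_left, Rmax_right by trivial; intros t Ht.
  apply (Hd t Ht). apply (Hc t Ht). }
assert (H2 : RInt (fun t => Im (df t)) a b = (Im (f b) - Im (f a))%R).
{ apply is_RInt_unique.
  apply (is_RInt_derive (V := R_CompleteNormedModule) (fun t => Im (f t)));
  rewrite Rmin_left, Rmax_right by trivial; intros t Ht.
  apply (Hd t Ht). apply (Hc t Ht). }
rewrite H1, H2. reflexivity.
Qed.

(** * Goursat's theorem for a homotopy *)

Lemma path_derive_mult f g t a b :
  path_derive f t a -> path_derive g t b ->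
  path_derive (fun s => f s * g s) t (a * g t + f t * b).
Proof.
intros [H1 H2] [H3 H4]; split.
- replace (Re (a * g t + f t * b))
   with ((Re a * Re (g t) + Re (f t) * Re b) - (Im a * Im (g t) + Im (f t) * Im b))%R
   by (unfold Re, Im; simpl; ring).
  apply (is_derive_minus (V := R_NormedModule) (fun s => Re (f s) * Re (g s))%R
    (fun s => Im (f s) * Im (g s))%R);
  apply (is_derive_mult (K := R_AbsRing)); trivial; apply Rmult_comm.
- replace (Im (a * g t + f t * b))
   with ((Re a * Im (g t) + Re (f t) * Im b) + (Im a * Re (g t) + Im (f t) * Re b))%R
   by (unfold Re, Im; simpl; ring).
  apply (is_derive_plus (V := R_NormedModule) (fun s => Re (f s) * Im (g s))%R
    (fun s => Im (f s) * Re (g s))%R);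
  apply (is_derive_mult (K := R_AbsRing)); trivial; apply Rmult_comm.
Qed.

Lemma path_derive_plus f g t a b :
  path_derive f t a -> path_derive g t b ->
  path_derive (fun s => f s + g s) t (a + b).
Proof.
intros [H1 H2] [H3 H4]; split; simpl;
apply (is_derive_plus (V := R_NormedModule)); assumption.
Qed.

Lemma path_derive_const c t : path_derive (fun _ => c) t 0.
Proof. split; apply (is_derive_const (V := R_NormedModule)). Qed.

Lemma path_derive_ext_val f t a b : path_derive f t a -> a = b -> path_derive f t b.
Proof. now intros H <-. Qed.

(* The linear part A + B (z - z0) has a primitive, so it contributes only the
   difference of end values. *)
Lemma path_integral_affine_approx g gam dgam a b z0 A B eta M D :
  (a <= b)%R -> (0 <= eta)%R ->
  (forall t, (a <= t <= b)%R -> path_derive gam t (dgam t)) ->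
  (forall t, (a <= t <= b)%R -> path_continuous dgam t) ->
  (forall t, (a <= t <= b)%R -> path_continuous (fun s => g (gam s)) t) ->
  (forall t, (a <= t <= b)%R -> (Cmod (dgam t) <= M)%R) ->
  (forall t, (a <= t <= b)%R -> (Cmod (gam t - z0) <= D)%R) ->
  (forall t, (a <= t <= b)%R ->
     (Cmod (g (gam t) - A - B * (gam t - z0)) <= eta * Cmod (gam t - z0))%R) ->
  let Q := fun z => A * z + B / 2 * ((z - z0) * (z - z0)) in
  (Cmod (CInt (fun t => (g (gam t) * dgam t)%C) a b - (Q (gam b) - Q (gam a)))
     <= (b - a) * (eta * D * M))%R.
Proof.
intros Hab Heta Hd Hcd Hcg HM HD Happ Q.
assert (Hc : forall t, (a <= t <= b)%R -> path_continuous gam t).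
{ intros t Ht. eapply path_derive_continuous. now apply Hd. }
assert (HcL : forall t, (a <= t <= b)%R ->
  path_continuous (fun t => (A + B * (gam t - z0)) * dgam t) t).
{ intros t Ht. apply path_continuous_mult; [|now apply Hcd].
  apply path_continuous_plus; [apply path_continuous_const|].
  apply path_continuous_mult; [apply path_continuous_const|].
  apply path_continuous_plus; [now apply Hc|apply path_continuous_const]. }
assert (HL : CInt (fun t => (A + B * (gam t - z0)) * dgam t) a b = Q (gam b) - Q (gam a)).
{ apply (CInt_derive (fun t => Q (gam t))); trivial.
  intros t Ht. unfold Q.
  assert (Hz : path_derive (fun s => gam s - z0) t (dgam t + 0)).
  { apply path_derive_plus; [now apply Hd|apply path_derive_const]. }
  pose proof (path_derive_mult _ _ _ _ _ (path_derive_const A t) (Hd t Ht)) as H1.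
  pose proof (path_derive_mult _ _ _ _ _ (path_derive_const (B / 2) t)
    (path_derive_mult _ _ _ _ _ Hz Hz)) as H2.
  apply (path_derive_ext_val _ _ _ _ (path_derive_plus _ _ _ _ _ H1 H2)).
  field. }
rewrite <- HL, <- CInt_minus; trivial.
2: intros t Ht; apply path_continuous_mult; [now apply Hcg|now apply Hcd].
apply Cmod_CInt_le; trivial.
- intros t Ht. apply path_continuous_plus.
  + apply path_continuous_mult; [now apply Hcg|now apply Hcd].
  + apply path_continuous_opp. now apply HcL.
- intros t Ht.
  replace (g (gam t) * dgam t - (A + B * (gam t - z0)) * dgam t)
   with ((g (gam t) - A - B * (gam t - z0)) * dgam t) by ring.
  rewrite Cmod_mult.
  apply Rmult_le_compat; try apply Cmod_ge_0; [|now apply HM].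
  eapply Rle_trans; [now apply Happ|].
  apply Rmult_le_compat_l; trivial. now apply HD.
Qed.

(** The mean value theorem with equality fails for complex-valued paths; the increment is bounded as
    the integral of the derivative instead. *)
Lemma path_lipschitz gam dgam a b M :
  (forall t, (Rmin a b <= t <= Rmax a b)%R -> path_derive gam t (dgam t)) ->
  (forall t, (Rmin a b <= t <= Rmax a b)%R -> path_continuous dgam t) ->
  (forall t, (Rmin a b <= t <= Rmax a b)%R -> (Cmod (dgam t) <= M)%R) ->
  (Cmod (gam b - gam a) <= M * Rabs (b - a))%R.
Proof.
assert (Hle : forall a b, (a <= b)%R ->
  (forall t, (a <= t <= b)%R -> path_derive gam t (dgam t)) ->
  (forall t, (a <= t <= b)%R -> path_continuous dgam t) ->
  (forall t, (a <= t <= b)%R -> (Cmod (dgam t) <= M)%R) ->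
  (Cmod (gam b - gam a) <= M * Rabs (b - a))%R).
{ clear a b. intros a b Hab Hd Hc HM.
  rewrite <- (CInt_derive gam dgam a b) by trivial.
  rewrite Rabs_pos_eq by lra. rewrite Rmult_comm. now apply Cmod_CInt_le. }
destruct (Rle_dec a b) as [Hab|Hab].
- rewrite Rmin_left, Rmax_right by trivial. now apply Hle.
- rewrite Rmin_right, Rmax_left by lra. intros.
  rewrite Cmod_sub_sym, Rabs_minus_sym. apply Hle; trivial; lra.
Qed.

(* The integral of g(z) dz over the image under Phi of the boundary of
   [a, b] x [c, d]; the orientation is opposite to the usual one. *)
Definition boundary_integral (g : C -> C) (Phi Ps Pt : R -> R -> C) (a b c d : R) : C :=
  (CInt (fun t => g (Phi b t) * Pt b t) c d - CInt (fun t => g (Phi a t) * Pt a t) c d)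
  - (CInt (fun s => g (Phi s d) * Ps s d) a b - CInt (fun s => g (Phi s c) * Ps s c) a b).

(** Every inner edge is traversed twice, in opposite directions, and cancels. *)
Lemma boundary_integral_split g Phi Ps Pt a m b c n d :
  (a <= m)%R -> (m <= b)%R -> (c <= n)%R -> (n <= d)%R ->
  (forall s t, (a <= s <= b)%R -> (c <= t <= d)%R ->
     path_continuous (fun s => g (Phi s t) * Ps s t) s) ->
  (forall s t, (a <= s <= b)%R -> (c <= t <= d)%R ->
     path_continuous (fun t => g (Phi s t) * Pt s t) t) ->
  boundary_integral g Phi Ps Pt a b c d =
    boundary_integral g Phi Ps Pt a m c n + boundary_integral g Phi Ps Pt m b c n +
    boundary_integral g Phi Ps Pt a m n d + boundary_integral g Phi Ps Pt m b n d.
Proof.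
intros Ham Hmb Hcn Hnd H1 H2. unfold boundary_integral.
rewrite (CInt_Chasles (fun t => g (Phi b t) * Pt b t) c n d),
 (CInt_Chasles (fun t => g (Phi a t) * Pt a t) c n d),
 (CInt_Chasles (fun s => g (Phi s d) * Ps s d) a m b),
 (CInt_Chasles (fun s => g (Phi s c) * Ps s c) a m b); trivial.
- ring.
- intros s Hs. apply (H1 s c); lra.
- intros s Hs. apply (H1 s d); lra.
- intros t Ht. apply (H2 a t); lra.
- intros t Ht. apply (H2 b t); lra.
Qed.

Lemma Cmod_le_four x1 x2 x3 x4 (e : R) :
  (Cmod x1 <= e)%R -> (Cmod x2 <= e)%R -> (Cmod x3 <= e)%R -> (Cmod x4 <= e)%R ->
  (Cmod (x1 + x2 + x3 + x4) <= 4 * e)%R.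
Proof.
intros. pose proof (Cmod_triangle (x1 + x2 + x3) x4).
pose proof (Cmod_triangle (x1 + x2) x3). pose proof (Cmod_triangle x1 x2). lra.
Qed.

(** Goursat's argument, run in the parameter square: for any c > 0 the integral around a subsquare
    of side h is at most c h^2. This bound is stable under quartering, since 4 (h/2)^2 = h^2, and
    near a given point it follows from the first-order expansion of [g]. *)
Lemma boundary_integral_eq_0 g Phi Ps Pt M :
  (forall s t, (0 <= s <= 1)%R -> (0 <= t <= 1)%R -> exists l, C_diff g (Phi s t) l) ->
  (forall s t, path_derive (fun s => Phi s t) s (Ps s t)) ->
  (forall s t, path_derive (fun t => Phi s t) t (Pt s t)) ->
  (forall s t, path_continuous (fun s => Ps s t) s) ->
  (forall s t, path_continuous (fun t => Pt s t) t) ->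
  (forall s t, (0 <= s <= 1)%R -> (0 <= t <= 1)%R -> (Cmod (Ps s t) <= M)%R) ->
  (forall s t, (0 <= s <= 1)%R -> (0 <= t <= 1)%R -> (Cmod (Pt s t) <= M)%R) ->
  boundary_integral g Phi Ps Pt 0 1 0 1 = 0.
Proof.
intros Hg Hs Ht Hcs Hct HMs HMt.
assert (HM : (0 <= M)%R).
{ apply Rle_trans with (Cmod (Ps 0%R 0%R)); [apply Cmod_ge_0|apply HMs; lra]. }
assert (Hcg1 : forall s t, (0 <= s <= 1)%R -> (0 <= t <= 1)%R ->
  path_continuous (fun s => g (Phi s t)) s).
{ intros s t H1 H2. destruct (Hg s t H1 H2) as [l Hl].
  apply (path_continuous_comp g l (fun s => Phi s t)); trivial.
  eapply path_derive_continuous. apply Hs. }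
assert (Hcg2 : forall s t, (0 <= s <= 1)%R -> (0 <= t <= 1)%R ->
  path_continuous (fun t => g (Phi s t)) t).
{ intros s t H1 H2. destruct (Hg s t H1 H2) as [l Hl].
  apply (path_continuous_comp g l (fun t => Phi s t)); trivial.
  eapply path_derive_continuous. apply Ht. }
enough (Hc : forall c : R, (0 < c)%R ->
  (Cmod (boundary_integral g Phi Ps Pt 0 1 0 1) <= c)%R).
{ apply Cmod_eq_0. apply Rle_antisym; [|apply Cmod_ge_0].
  apply Rnot_lt_le. intros Hn.
  assert (Hh : (0 < Cmod (boundary_integral g Phi Ps Pt 0 1 0 1) / 2)%R) by lra.
  specialize (Hc _ Hh). lra. }
intros c Hc.
(* The bisection lemma ranges over all squares of the plane, so the requirement of lying inside the
   unit square is built into [P]. *)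
set (P := fun x y h : R => (0 <= x -> x + h <= 1 -> 0 <= y -> y + h <= 1 ->
  Cmod (boundary_integral g Phi Ps Pt x (x + h) y (y + h)) <= c * (h * h))%R).
assert (HP : P 0%R 0%R 1%R).
2:{ unfold P in HP. rewrite !Rplus_0_l in HP. specialize (HP ltac:(lra) ltac:(lra)
     ltac:(lra) ltac:(lra)). lra. }
apply square_bisection.
- intros x y h Hh P1 P2 P3 P4 Hx0 Hx1 Hy0 Hy1.
  specialize (P1 ltac:(lra) ltac:(lra) ltac:(lra) ltac:(lra)).
  specialize (P2 ltac:(lra) ltac:(lra) ltac:(lra) ltac:(lra)).
  specialize (P3 ltac:(lra) ltac:(lra) ltac:(lra) ltac:(lra)).
  specialize (P4 ltac:(lra) ltac:(lra) ltac:(lra) ltac:(lra)).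
  replace (x + h / 2 + h / 2)%R with (x + h)%R in * by field.
  replace (y + h / 2 + h / 2)%R with (y + h)%R in * by field.
  rewrite (boundary_integral_split _ _ _ _ _ (x + h / 2) _ _ (y + h / 2)); try lra.
  + replace (c * (h * h))%R with (4 * (c * (h / 2 * (h / 2))))%R by field.
    now apply Cmod_le_four.
  + intros s t Hs1 Ht1. apply path_continuous_mult; [apply Hcg1; lra|apply Hcs].
  + intros s t Hs1 Ht1. apply path_continuous_mult; [apply Hcg2; lra|apply Hct].
- intros X Y HX HY.
  destruct (Hg X Y HX HY) as [B HB].
  set (z0 := Phi X Y) in *. set (A := g z0) in *.
  (* Each of the four sides has length h and contributes an error of at most h * (eta * 2Mh * M), in
     total 8 M^2 eta h^2. The summand 1 keeps the denominator positive when M = 0. *)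
  set (eta := (c / (8 * M * M + 1))%R).
  assert (Heta : (0 < eta)%R) by (apply Rdiv_lt_0_compat; nra).
  destruct (HB eta Heta) as [d [Hd0 Hd]].
  (* On a square of side h containing (X, Y), [Phi] stays within 2Mh of [z0]: at most Mh for each
     coordinate. This must stay below [d]. *)
  exists (d / (2 * M + 1))%R.
  split; [apply Rdiv_lt_0_compat; lra|].
  intros x y h [Hh0 Hh] HXx HYy Hx0 Hx1 Hy0 Hy1.
  assert (Hhd : (2 * M * h < d)%R).
  { apply (Rmult_lt_compat_r (2 * M + 1)) in Hh; [|lra].
    replace (d / (2 * M + 1) * (2 * M + 1))%R with d in Hh by (field; lra). lra. }
  assert (HD : forall s t, (x <= s <= x + h)%R -> (y <= t <= y + h)%R ->
    (Cmod (Phi s t - z0) <= 2 * M * h)%R).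
  { intros s t Hs1 Ht1. unfold z0.
    replace (Phi s t - Phi X Y) with ((Phi s t - Phi X t) + (Phi X t - Phi X Y)) by ring.
    eapply Rle_trans; [apply Cmod_triangle|].
    assert (L1 : (Cmod (Phi s t - Phi X t) <= M * Rabs (s - X))%R).
    { apply (path_lipschitz (fun s => Phi s t) (fun s => Ps s t)); auto.
      intros r Hr. apply HMs; [|lra]. revert Hr.
      unfold Rmin, Rmax. destruct (Rle_dec X s); lra. }
    assert (L2 : (Cmod (Phi X t - Phi X Y) <= M * Rabs (t - Y))%R).
    { apply (path_lipschitz (fun t => Phi X t) (fun t => Pt X t)); auto.
      intros r Hr. apply HMt; [lra|]. revert Hr.
      unfold Rmin, Rmax. destruct (Rle_dec Y t); lra. }
    assert (Rabs (s - X) <= h)%R by (apply Rabs_le; lra).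
    assert (Rabs (t - Y) <= h)%R by (apply Rabs_le; lra).
    nra. }
  assert (Happ : forall s t, (x <= s <= x + h)%R -> (y <= t <= y + h)%R ->
    (Cmod (g (Phi s t) - A - B * (Phi s t - z0)) <= eta * Cmod (Phi s t - z0))%R).
  { intros s t Hs1 Ht1. apply Hd. eapply Rle_lt_trans; [now apply HD|exact Hhd]. }
  assert (S1 : forall t, (t = y \/ t = y + h)%R ->
    (Cmod (CInt (fun s => (g (Phi s t) * Ps s t)%C) x (x + h) -
      ((A * Phi (x + h)%R t + B / 2 * ((Phi (x + h)%R t - z0) * (Phi (x + h)%R t - z0))) -
       (A * Phi x t + B / 2 * ((Phi x t - z0) * (Phi x t - z0))))) <=
      (x + h - x) * (eta * (2 * M * h) * M))%R).
  { intros t Hty.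
    apply (path_integral_affine_approx g (fun s => Phi s t) (fun s => Ps s t));
      try lra; auto; intros s Hs1.
    - apply Hcg1; lra.
    - apply HMs; lra.
    - apply HD; lra.
    - apply Happ; lra. }
  assert (S2 : forall s, (s = x \/ s = x + h)%R ->
    (Cmod (CInt (fun t => (g (Phi s t) * Pt s t)%C) y (y + h) -
      ((A * Phi s (y + h)%R + B / 2 * ((Phi s (y + h)%R - z0) * (Phi s (y + h)%R - z0))) -
       (A * Phi s y + B / 2 * ((Phi s y - z0) * (Phi s y - z0))))) <=
      (y + h - y) * (eta * (2 * M * h) * M))%R).
  { intros s Hsx.
    apply (path_integral_affine_approx g (fun t => Phi s t) (fun t => Pt s t));
      try lra; auto; intros t Ht1.
    - apply Hcg2; lra.
    - apply HMt; lra.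
    - apply HD; lra.
    - apply Happ; lra. }
  pose proof (S1 _ (or_introl eq_refl)) as E1.
  pose proof (S1 _ (or_intror eq_refl)) as E2.
  pose proof (S2 _ (or_introl eq_refl)) as E3.
  pose proof (S2 _ (or_intror eq_refl)) as E4.
  clear S1 S2 Happ HD.
  rewrite Rplus_minus_l in E1, E2, E3, E4.
  rewrite <- Cmod_opp in E2, E3.
  pose proof (Cmod_le_four _ _ _ _ _ E4 E3 E2 E1) as E.
  (* The values of the quadratic primitive at the four corners cancel around the boundary, so [ring]
     identifies the signed sum of the four errors with the boundary integral. *)
  match type of E with (Cmod ?u <= _)%R => match goal with |- (Cmod ?v <= _)%R =>
    replace v with u by (unfold boundary_integral; ring) end end.
  eapply Rle_trans; [exact E|].
  replace (4 * (h * (eta * (2 * M * h) * M)))%R with (eta * (8 * M * M) * (h * h))%R by ring.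
  apply Rmult_le_compat_r; [nra|].
  apply Rle_trans with (eta * (8 * M * M + 1))%R; [nra|].
  right. unfold eta. field. nra.
Qed.

(** * Cauchy's formula and its consequences *)

Definition C_differentiable (f : C -> C) (z : C) : Prop := exists l, C_diff f z l.

Lemma C_differentiable_const c z : C_differentiable (fun _ => c) z.
Proof.
exists 0. intros eps He. exists 1%R. split; [lra|]. intros y _.
replace (c - c - 0 * (y - z)) with (RtoC 0) by ring.
rewrite Cmod_0. apply Rmult_le_pos; [lra|apply Cmod_ge_0].
Qed.

Lemma C_differentiable_id z : C_differentiable (fun y => y) z.
Proof.
exists 1. intros eps He. exists 1%R. split; [lra|]. intros y _.
replace (y - z - 1 * (y - z)) with (RtoC 0) by ring.
rewrite Cmod_0. apply Rmult_le_pos; [lra|apply Cmod_ge_0].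
Qed.

Lemma C_diff_lipschitz f z l : C_diff f z l -> exists delta : R, (0 < delta)%R /\
  forall y, (Cmod (y - z) < delta)%R ->
    (Cmod (f y - f z) <= (Cmod l + 1) * Cmod (y - z))%R.
Proof.
intros H. destruct (H 1%R Rlt_0_1) as [d [Hd0 Hd]]. exists d. split; trivial.
intros y Hy. specialize (Hd y Hy).
replace (f y - f z) with ((f y - f z - l * (y - z)) + l * (y - z)) by ring.
eapply Rle_trans; [apply Cmod_triangle|]. rewrite Cmod_mult. lra.
Qed.

Lemma C_differentiable_continuous f z : C_differentiable f z ->
  forall eps : R, (0 < eps)%R -> exists delta : R, (0 < delta)%R /\
    forall y, (Cmod (y - z) < delta)%R -> (Cmod (f y - f z) < eps)%R.
Proof.
intros [l Hl] eps He. destruct (C_diff_lipschitz f z l Hl) as [d [Hd0 Hd]].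
pose proof (Cmod_ge_0 l) as Hl0.
exists (Rmin d (eps / (Cmod l + 1))). split.
{ apply Rmin_pos; trivial. apply Rdiv_lt_0_compat; lra. }
intros y Hy.
eapply Rle_lt_trans.
{ apply Hd. eapply Rlt_le_trans; [exact Hy|apply Rmin_l]. }
apply Rlt_le_trans with ((Cmod l + 1) * (eps / (Cmod l + 1)))%R.
{ apply Rmult_lt_compat_l; [lra|]. eapply Rlt_le_trans; [exact Hy|apply Rmin_r]. }
right. field. lra.
Qed.

Lemma C_differentiable_plus f g z :
  C_differentiable f z -> C_differentiable g z ->
  C_differentiable (fun y => f y + g y) z.
Proof.
intros [a Ha] [b Hb]. exists (a + b). intros eps He.
destruct (Ha (eps / 2)%R ltac:(lra)) as [d1 [Hd1 H1]].
destruct (Hb (eps / 2)%R ltac:(lra)) as [d2 [Hd2 H2]].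
exists (Rmin d1 d2). split; [now apply Rmin_pos|]. intros y Hy.
specialize (H1 y ltac:(eapply Rlt_le_trans; [exact Hy|apply Rmin_l])).
specialize (H2 y ltac:(eapply Rlt_le_trans; [exact Hy|apply Rmin_r])).
replace (f y + g y - (f z + g z) - (a + b) * (y - z)) with
 ((f y - f z - a * (y - z)) + (g y - g z - b * (y - z))) by ring.
eapply Rle_trans; [apply Cmod_triangle|]. lra.
Qed.

Lemma C_differentiable_mult f g z :
  C_differentiable f z -> C_differentiable g z ->
  C_differentiable (fun y => f y * g y) z.
Proof.
intros [a Ha] [b Hb]. exists (a * g z + f z * b). intros eps He.
pose proof (Cmod_ge_0 (f z)) as Hf0. pose proof (Cmod_ge_0 (g z)) as Hg0.
pose proof (Cmod_ge_0 a) as Ha0. pose proof (Cmod_ge_0 b) as Hb0.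
set (N := (Cmod (f z) + Cmod (g z) + (Cmod a + 1) * (Cmod b + 1))%R).
assert (HN : (0 < N)%R) by (unfold N; nra).
assert (He' : (0 < eps / N)%R) by (apply Rdiv_lt_0_compat; lra).
destruct (Ha _ He') as [d1 [Hd1 H1]].
destruct (Hb _ He') as [d2 [Hd2 H2]].
destruct (C_diff_lipschitz f z a Ha) as [d3 [Hd3 H3]].
destruct (C_diff_lipschitz g z b Hb) as [d4 [Hd4 H4]].
exists (Rmin (Rmin d1 d2) (Rmin (Rmin d3 d4) (eps / N))).
split; [repeat apply Rmin_pos; trivial|]. intros y Hy.
apply Rmin_Rgt_l in Hy. destruct Hy as [Hy1 Hy2].
apply Rmin_Rgt_l in Hy1. destruct Hy1 as [Hy1 Hy1'].
apply Rmin_Rgt_l in Hy2. destruct Hy2 as [Hy2 Hy3].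
apply Rmin_Rgt_l in Hy2. destruct Hy2 as [Hy2 Hy2'].
specialize (H1 y Hy1). specialize (H2 y Hy1').
specialize (H3 y Hy2). specialize (H4 y Hy2').
replace (f y * g y - f z * g z - (a * g z + f z * b) * (y - z)) with
 ((f y - f z - a * (y - z)) * g z + f z * (g y - g z - b * (y - z))
  + (f y - f z) * (g y - g z)) by ring.
eapply Rle_trans; [apply Cmod_triangle|].
eapply Rle_trans; [apply Rplus_le_compat_r, Cmod_triangle|].
rewrite !Cmod_mult.
set (r := Cmod (y - z)) in *. assert (Hr : (0 <= r)%R) by apply Cmod_ge_0.
apply Rle_trans with
  (eps / N * r * Cmod (g z) + Cmod (f z) * (eps / N * r)
   + (Cmod a + 1) * r * ((Cmod b + 1) * r))%R.
{ apply Rplus_le_compat; [apply Rplus_le_compat|].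
  - now apply Rmult_le_compat_r.
  - now apply Rmult_le_compat_l.
  - apply Rmult_le_compat; trivial; apply Cmod_ge_0. }
apply Rle_trans with (eps / N * N * r)%R; [|right; field; lra].
set (q := (eps / N)%R) in *. unfold N.
assert ((Cmod a + 1) * r * ((Cmod b + 1) * r) <=
  q * ((Cmod a + 1) * (Cmod b + 1)) * r)%R.
{ replace ((Cmod a + 1) * r * ((Cmod b + 1) * r))%R with
   (r * ((Cmod a + 1) * (Cmod b + 1)) * r)%R by ring.
  apply Rmult_le_compat_r; trivial. apply Rmult_le_compat_r; [nra|lra]. }
lra.
Qed.

Lemma C_differentiable_comp f g z :
  C_differentiable f z -> C_differentiable g (f z) ->
  C_differentiable (fun y => g (f y)) z.
Proof.
intros [a Ha] [b Hb]. exists (b * a). intros eps He.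
pose proof (Cmod_ge_0 a) as Ha0. pose proof (Cmod_ge_0 b) as Hb0.
set (N := (Cmod a + 1 + Cmod b)%R).
assert (HN : (0 < N)%R) by (unfold N; lra).
assert (He' : (0 < eps / N)%R) by (apply Rdiv_lt_0_compat; lra).
destruct (Hb _ He') as [d1 [Hd1 H1]].
destruct (Ha _ He') as [d2 [Hd2 H2]].
destruct (C_diff_lipschitz f z a Ha) as [d3 [Hd3 H3]].
exists (Rmin (Rmin d2 d3) (d1 / (Cmod a + 1))).
split; [repeat apply Rmin_pos; trivial; apply Rdiv_lt_0_compat; lra|]. intros y Hy.
apply Rmin_Rgt_l in Hy. destruct Hy as [Hy1 Hy3].
apply Rmin_Rgt_l in Hy1. destruct Hy1 as [Hy1 Hy2].
specialize (H2 y Hy1). specialize (H3 y Hy2).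
assert (Hy : (Cmod (f y - f z) < d1)%R).
{ eapply Rle_lt_trans; [exact H3|].
  apply Rlt_le_trans with ((Cmod a + 1) * (d1 / (Cmod a + 1)))%R.
  - apply Rmult_lt_compat_l; lra.
  - right. field. lra. }
specialize (H1 _ Hy).
replace (g (f y) - g (f z) - b * a * (y - z)) with
 ((g (f y) - g (f z) - b * (f y - f z)) + b * (f y - f z - a * (y - z))) by ring.
eapply Rle_trans; [apply Cmod_triangle|]. rewrite Cmod_mult.
set (r := Cmod (y - z)) in *. assert (Hr : (0 <= r)%R) by apply Cmod_ge_0.
apply Rle_trans with (eps / N * ((Cmod a + 1) * r) + Cmod b * (eps / N * r))%R.
{ apply Rplus_le_compat.
  - eapply Rle_trans; [exact H1|]. apply Rmult_le_compat_l; lra.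
  - now apply Rmult_le_compat_l. }
right. unfold N. field. unfold N in HN. lra.
Qed.

Lemma C_differentiable_Cinv (z : C) : z <> 0 -> C_differentiable (fun y => / y) z.
Proof.
intros Hz. exists (- (/ (z * z))). intros eps He.
assert (Hz0 : (0 < Cmod z)%R) by exact (proj1 (Cmod_gt_0 z) Hz).
set (m := Cmod z) in *.
exists (Rmin (m / 2) (eps * (m * m * m) / 2)). split.
{ apply Rmin_pos; [lra|]. apply Rdiv_lt_0_compat; [|lra].
  repeat apply Rmult_lt_0_compat; trivial. }
intros y Hy. apply Rmin_Rgt_l in Hy. destruct Hy as [Hy1 Hy2].
assert (Hym : (m / 2 < Cmod y)%R).
{ assert (m <= Cmod y + Cmod (y - z))%R; [|lra].
  unfold m. replace z with (y + - (y - z)) at 1 by ring.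
  eapply Rle_trans; [apply Cmod_triangle|]. rewrite Cmod_opp. lra. }
assert (Hy0 : y <> 0).
{ intros E. rewrite E, Cmod_0 in Hym. lra. }
replace (/ y - / z - - / (z * z) * (y - z)) with ((y - z) * (y - z) * / (y * (z * z)))
 by (field; tauto).
assert (y * (z * z) <> 0) by (repeat apply Cmult_neq_0; trivial).
rewrite !Cmod_mult, Cmod_inv, !Cmod_mult by trivial. fold m.
set (r := Cmod (y - z)) in *. assert (Hr : (0 <= r)%R) by apply Cmod_ge_0.
assert (Hmm : (0 < m * m)%R) by nra.
replace (r * r * / (Cmod y * (m * m)))%R with (r * / (Cmod y * (m * m)) * r)%R by ring.
apply Rmult_le_compat_r; trivial.
apply Rmult_le_reg_r with (Cmod y * (m * m))%R; [nra|].
rewrite Rmult_assoc, Rinv_l by nra.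
assert (eps * (m * m * (m / 2)) <= eps * (m * m * Cmod y))%R.
{ apply Rmult_le_compat_l; [lra|]. apply Rmult_le_compat_l; lra. }
lra.
Qed.

Lemma C_differentiable_inv f z :
  C_differentiable f z -> f z <> 0 -> C_differentiable (fun y => / f y) z.
Proof.
intros Hf Hz. apply (C_differentiable_comp f); trivial. now apply C_differentiable_Cinv.
Qed.

Lemma C_differentiable_minus_const c z : C_differentiable (fun y => y - c) z.
Proof.
apply C_differentiable_plus; [apply C_differentiable_id|apply C_differentiable_const].
Qed.

Lemma C_differentiable_ext_loc f g z (d : R) : (0 < d)%R ->
  (forall y, (Cmod (y - z) < d)%R -> f y = g y) ->
  C_differentiable f z -> C_differentiable g z.
Proof.
intros Hd0 Heq [l Hl]. exists l. intros eps He. destruct (Hl eps He) as [d' [Hd' H]].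
exists (Rmin d d'). split; [now apply Rmin_pos|]. intros y Hy.
apply Rmin_Rgt_l in Hy. destruct Hy as [Hy1 Hy2].
rewrite <- (Heq y Hy1), <- (Heq z). { now apply H. }
replace (z - z) with (RtoC 0) by ring. rewrite Cmod_0. lra.
Qed.

(** * Circles as paths over [0, 1], and Cauchy's formula on them *)

Definition cis (t : R) : C := (cos (2 * PI * t), sin (2 * PI * t)).

Lemma Cmod_cis t : Cmod (cis t) = 1%R.
Proof.
unfold Cmod, cis. simpl. rewrite !Rmult_1_r.
pose proof (sin2_cos2 (2 * PI * t)) as H. unfold Rsqr in H.
rewrite Rplus_comm, H. apply sqrt_1.
Qed.

Lemma cis_0 : cis 0 = 1.
Proof. unfold cis. rewrite Rmult_0_r, cos_0, sin_0. reflexivity. Qed.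

Lemma cis_1 : cis 1 = 1.
Proof. unfold cis. rewrite Rmult_1_r, cos_2PI, sin_2PI. reflexivity. Qed.

Lemma cis_neq_0 t : cis t <> 0.
Proof. apply Cmod_gt_0. rewrite Cmod_cis. lra. Qed.

Lemma cis_conj t : cis t * Cconj (cis t) = 1.
Proof. rewrite <- Cmod2_conj, Cmod_cis. simpl. now rewrite !Rmult_1_r. Qed.

Lemma path_derive_cis t : path_derive cis t (RtoC (2 * PI) * Ci * cis t).
Proof.
split; unfold cis, Ci, RtoC, Re, Im; simpl; auto_derive; trivial; ring.
Qed.

Lemma path_continuous_cis t : path_continuous cis t.
Proof. eapply path_derive_continuous. apply path_derive_cis. Qed.

Lemma Cmod_RtoC_cis (r : R) t : (0 <= r)%R -> Cmod (r * cis t) = r.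
Proof. intros Hr. rewrite Cmod_mult, Cmod_cis, Cmod_R, Rabs_pos_eq; lra. Qed.

Lemma CInt_scal (c : C) f a b : (a <= b)%R ->
  (forall t, (a <= t <= b)%R -> path_continuous f t) ->
  CInt (fun t => c * f t) a b = c * CInt f a b.
Proof.
intros Hab H.
assert (H1 : ex_RInt (fun t => Re (f t)) a b).
{ apply (ex_RInt_continuous (V := R_CompleteNormedModule)).
  rewrite Rmin_left, Rmax_right by trivial. intros t Ht. apply (H t Ht). }
assert (H2 : ex_RInt (fun t => Im (f t)) a b).
{ apply (ex_RInt_continuous (V := R_CompleteNormedModule)).
  rewrite Rmin_left, Rmax_right by trivial. intros t Ht. apply (H t Ht). }
apply (RInt_correct (V := R_CompleteNormedModule)) in H1, H2.
unfold CInt, Cmult. simpl. f_equal; apply is_RInt_unique.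
- apply (is_RInt_minus (V := R_NormedModule));
  apply (is_RInt_scal (V := R_NormedModule)); trivial.
- apply (is_RInt_plus (V := R_NormedModule));
  apply (is_RInt_scal (V := R_NormedModule)); trivial.
Qed.

Lemma path_continuous_differentiable g f t :
  C_differentiable g (f t) -> path_continuous f t -> path_continuous (fun s => g (f s)) t.
Proof. intros [l Hl]. now apply (path_continuous_comp g l). Qed.

Lemma path_continuous_circle (w : C) (r t : R) : path_continuous (fun t => w + r * cis t) t.
Proof.
apply path_continuous_plus; [apply path_continuous_const|].
apply path_continuous_mult; [apply path_continuous_const|apply path_continuous_cis].
Qed.

Lemma two_PI_Ci_neq_0 : RtoC (2 * PI) * Ci <> 0.
Proof.
apply Cmod_gt_0. rewrite Cmod_mult, Cmod_Ci, Cmod_R.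
pose proof PI_RGT_0. rewrite Rabs_pos_eq; lra.
Qed.

(* Cauchy's theorem for f(z)/(z-w) along the linear homotopy from the small
   circle w + eps e^(i theta) to the circle of radius rho about 0. *)
Lemma cauchy_kernel_small_circle f (rad rho eps : R) w :
  (rho < rad)%R -> (forall z, (Cmod z < rad)%R -> C_differentiable f z) ->
  (0 < eps)%R -> (Cmod w + eps <= rho)%R ->
  CInt (fun t => f (rho * cis t) * (rho * cis t / (rho * cis t - w))) 0 1 =
  CInt (fun t => f (w + eps * cis t)) 0 1.
Proof.
intros Hrho Hf Heps Hw.
set (Phi := fun s t : R => (1 - s)%R * w + ((1 - s) * eps + s * rho)%R * cis t).
set (Ps := fun s t : R => (rho - eps)%R * cis t - w).
set (Pt := fun s t : R => ((1 - s) * eps + s * rho)%R * (RtoC (2 * PI) * Ci * cis t)).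
set (g := fun z => f z / (z - w)).
pose proof (Cmod_ge_0 w) as Hw0. pose proof PI_RGT_0 as HPI.
assert (HPhi : forall s t, (0 <= s <= 1)%R -> (Cmod (Phi s t) <= rho)%R).
{ intros s t Hs. unfold Phi. eapply Rle_trans; [apply Cmod_triangle|].
  rewrite Cmod_RtoC_cis by nra. rewrite Cmod_mult, Cmod_R, Rabs_pos_eq by lra. nra. }
(* The homotopy avoids w: [Phi s t - w] is R cis(t) - s w with R = (1 - s) eps + s rho, and |w| +
   eps <= rho gives R - s |w| >= eps > 0. *)
assert (HPhiw : forall s t, (0 <= s <= 1)%R -> Phi s t - w <> 0).
{ intros s t Hs. apply Cmod_gt_0.
  assert (H : (Cmod (((1 - s) * eps + s * rho)%R * cis t) <= Cmod (Phi s t - w) + Cmod (s * w))%R).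
  { replace (((1 - s) * eps + s * rho)%R * cis t) with ((Phi s t - w) + s * w).
    apply Cmod_triangle.
    unfold Phi. rewrite RtoC_minus. ring. }
  rewrite Cmod_RtoC_cis in H by nra.
  rewrite Cmod_mult, Cmod_R, Rabs_pos_eq in H by lra. nra. }
assert (HB : boundary_integral g Phi Ps Pt 0 1 0 1 = 0).
{ apply (boundary_integral_eq_0 g Phi Ps Pt (2 * PI * rho + Cmod w + rho)).
  - intros s t Hs Ht. apply C_differentiable_mult.
    + apply Hf. eapply Rle_lt_trans; [now apply HPhi|trivial].
    + apply (C_differentiable_inv (fun z => z - w)).
      apply C_differentiable_minus_const. now apply HPhiw.
  - intros s t. unfold Phi, Ps, path_derive. simpl.
    split; unfold RtoC, cis; simpl; auto_derive; trivial; simpl; ring.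
  - intros s t. unfold Phi, Pt, path_derive. simpl.
    split; unfold RtoC, cis; simpl; auto_derive; trivial; simpl; ring.
  - intros s t. apply path_continuous_const.
  - intros s t. unfold Pt. apply path_continuous_mult; [apply path_continuous_const|].
    apply path_continuous_mult; [apply path_continuous_const|apply path_continuous_cis].
  - intros s t Hs Ht. unfold Ps. eapply Rle_trans; [apply Cmod_triangle|].
    rewrite Cmod_opp, Cmod_RtoC_cis by lra. nra.
  - intros s t Hs Ht. unfold Pt.
    rewrite !Cmod_mult, Cmod_Ci, Cmod_cis, !Cmod_R, !Rabs_pos_eq by nra.
    assert (((1 - s) * eps + s * rho) <= rho)%R by nra. nra. }
unfold boundary_integral in HB.
(* Since [cis] has period 1, the sides t = 0 and t = 1 of the parameter square have the same image
   and cancel; only the two circles remain. *)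
rewrite (CInt_ext (fun s => g (Phi s 1%R) * Ps s 1%R) (fun s => g (Phi s 0%R) * Ps s 0%R))
 in HB by (try lra; intros s Hs; unfold Phi, Ps; now rewrite cis_0, cis_1).
assert (HE : CInt (fun t => g (Phi 1%R t) * Pt 1%R t) 0 1 =
  CInt (fun t => g (Phi 0%R t) * Pt 0%R t) 0 1).
{ match type of HB with ?x - ?y - (?z - ?z) = _ =>
   replace x with ((x - y - (z - z)) + y) by ring end.
  rewrite HB. ring. }
assert (Hc1 : forall t, (0 <= t <= 1)%R ->
  path_continuous (fun t => f (rho * cis t) * (rho * cis t / (rho * cis t - w))) t).
{ intros t Ht.
  assert (Hcc : path_continuous (fun t => rho * cis t) t).
  { apply path_continuous_mult; [apply path_continuous_const|apply path_continuous_cis]. }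
  assert (Hne : rho * cis t - w <> 0).
  { pose proof (HPhiw 1%R t ltac:(lra)) as H. unfold Phi in H.
    contradict H. rewrite <- H. f_equal. rewrite Rminus_diag, Rmult_0_l, Rplus_0_l, Rmult_1_l.
    ring. }
  apply (path_continuous_differentiable (fun z => f z * (z / (z - w)))); trivial.
  apply C_differentiable_mult.
  - apply Hf. rewrite Cmod_RtoC_cis; lra.
  - apply C_differentiable_mult; [apply C_differentiable_id|].
    apply (C_differentiable_inv (fun z => z - w)); trivial.
    apply C_differentiable_minus_const. }
assert (Hc2 : forall t, (0 <= t <= 1)%R -> path_continuous (fun t => f (w + eps * cis t)) t).
{ intros t Ht. apply (path_continuous_differentiable f); [|apply path_continuous_circle].
  apply Hf. eapply Rle_lt_trans; [apply Cmod_triangle|].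
  rewrite Cmod_RtoC_cis; lra. }
rewrite (CInt_ext _ (fun t => RtoC (2 * PI) * Ci *
  (f (rho * cis t) * (rho * cis t / (rho * cis t - w))))) in HE; [|lra|].
2:{ intros t Ht. unfold g, Pt, Phi.
  rewrite Rminus_diag, Rmult_0_l, Rplus_0_l, Rmult_1_l, Cmult_0_l, Cplus_0_l.
  unfold Cdiv. ring. }
(* On the circle centred at w, dz / (z - w) is the constant 2 pi i dt, so the kernel disappears and
   a plain mean of [f] is left. *)
rewrite (CInt_ext (fun t => g (Phi 0%R t) * Pt 0%R t) (fun t => RtoC (2 * PI) * Ci *
  f (w + eps * cis t))) in HE; [|lra|].
2:{ intros t Ht. unfold g, Pt, Phi.
  rewrite Rminus_0_r, Rmult_0_l, Rplus_0_r, Rmult_1_l, Cmult_1_l.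
  replace (w + eps * cis t - w) with (eps * cis t) by ring.
  field. split; [apply cis_neq_0|]. intros E. apply RtoC_inj in E. lra. }
rewrite !CInt_scal in HE by (trivial; lra).
pose proof two_PI_Ci_neq_0 as Hk. set (k := RtoC (2 * PI) * Ci) in *.
match type of HE with _ * ?x = _ * ?y =>
  replace x with (/ k * (k * x)) by (field; trivial); rewrite HE; field; trivial end.
Qed.

Lemma CInt_const (c : C) a b : CInt (fun _ => c) a b = (b - a)%R * c.
Proof.
apply CInt_unique.
replace ((b - a)%R * c) with (scal (V := C_R_NormedModule) (b - a)%R c).
apply (is_RInt_const (V := C_R_NormedModule)).
destruct c as [x y]. unfold scal. simpl. unfold Cmult, prod_scal, scal. simpl.
unfold mult. simpl. f_equal; ring.
Qed.

(** The integral equals the mean of [f] over every sufficiently small circle about w, and these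
    means tend to f(w) by continuity. With zeta = rho cis(t), the factor zeta / (zeta - w) dt is d
    zeta / (2 pi i (zeta - w)). *)
Lemma cauchy_formula f (rad rho : R) w :
  (rho < rad)%R -> (forall z, (Cmod z < rad)%R -> C_differentiable f z) ->
  (Cmod w < rho)%R ->
  CInt (fun t => f (rho * cis t) * (rho * cis t / (rho * cis t - w))) 0 1 = f w.
Proof.
intros Hrho Hf Hw.
set (I := CInt _ 0 1).
enough (H : forall eta : R, (0 < eta)%R -> (Cmod (I - f w) <= eta)%R).
{ assert (H0 : I - f w = 0).
  { apply Cmod_eq_0. apply Rle_antisym; [|apply Cmod_ge_0].
    apply Rnot_lt_le. intros Hn. specialize (H (Cmod (I - f w) / 2)%R ltac:(lra)). lra. }
  replace I with ((I - f w) + f w) by ring. rewrite H0. ring. }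
intros eta Heta.
destruct (C_differentiable_continuous f w ltac:(apply Hf; lra) eta Heta) as [d [Hd0 Hd]].
set (eps := Rmin (d / 2) (rho - Cmod w)).
assert (He0 : (0 < eps)%R) by (apply Rmin_pos; lra).
assert (He1 : (eps <= d / 2)%R) by apply Rmin_l.
assert (He2 : (eps <= rho - Cmod w)%R) by apply Rmin_r.
unfold I. rewrite (cauchy_kernel_small_circle f rad rho eps w); trivial; try lra.
assert (Hc : forall t, (0 <= t <= 1)%R -> path_continuous (fun t => f (w + eps * cis t)) t).
{ intros t Ht. apply (path_continuous_differentiable f); [|apply path_continuous_circle].
  apply Hf. eapply Rle_lt_trans; [apply Cmod_triangle|].
  rewrite Cmod_RtoC_cis; lra. }
replace (f w) with (CInt (fun _ => f w) 0 1) by (rewrite CInt_const, Rminus_0_r; ring).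
rewrite <- CInt_minus; trivial; try lra.
2: intros; apply path_continuous_const.
replace eta with ((1 - 0) * eta)%R by ring.
apply Cmod_CInt_le; [lra| |].
- intros t Ht. apply path_continuous_plus; [now apply Hc|apply path_continuous_const].
- intros t Ht. left. apply Hd.
  replace (w + eps * cis t - w) with (eps * cis t) by ring.
  rewrite Cmod_RtoC_cis; lra.
Qed.

(** * Consequences of Cauchy's formula: local estimates and removable singularities *)

Lemma Cmod_sub_lower (x y : C) : (Cmod x - Cmod y <= Cmod (x - y))%R.
Proof.
replace x with ((x - y) + y) at 1 by ring.
pose proof (Cmod_triangle (x - y) y). lra.
Qed.

Lemma path_continuous_bounded f a b : (a <= b)%R ->
  (forall t, (a <= t <= b)%R -> path_continuous f t) ->
  exists M : R, forall t, (a <= t <= b)%R -> (Cmod (f t) <= M)%R.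
Proof.
intros Hab Hc.
destruct (bounded_continuity (V := R_NormedModule) (fun t => Re (f t)) a b) as [M1 H1].
{ intros t Ht. apply (Hc t Ht). }
destruct (bounded_continuity (V := R_NormedModule) (fun t => Im (f t)) a b) as [M2 H2].
{ intros t Ht. apply (Hc t Ht). }
exists (M1 + M2)%R. intros t Ht.
specialize (H1 t Ht). specialize (H2 t Ht).
change (Rabs (Re (f t)) < M1)%R in H1. change (Rabs (Im (f t)) < M2)%R in H2.
pose proof (Cmod_le_Re_Im (f t)). lra.
Qed.

Lemma path_continuous_on_circle f (rad rho : R) t :
  (0 <= rho < rad)%R -> (forall z, (Cmod z < rad)%R -> C_differentiable f z) ->
  path_continuous (fun t => f (rho * cis t)) t.
Proof.
intros Hrho Hf. apply (path_continuous_differentiable f).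
- apply Hf. rewrite Cmod_RtoC_cis; lra.
- apply path_continuous_mult; [apply path_continuous_const|apply path_continuous_cis].
Qed.

Lemma circle_minus_neq_0 (rho : R) w t :
  (Cmod w < rho)%R -> rho * cis t - w <> 0.
Proof.
intros Hw. pose proof (Cmod_ge_0 w). apply Cmod_gt_0.
pose proof (Cmod_sub_lower (rho * cis t) w) as H1.
rewrite Cmod_RtoC_cis in H1; lra.
Qed.

Lemma path_continuous_cauchy_kernel (rho : R) w t : (Cmod w < rho)%R ->
  path_continuous (fun t => rho * cis t / (rho * cis t - w)) t.
Proof.
intros Hw. apply (path_continuous_differentiable (fun z => z / (z - w))).
- apply C_differentiable_mult; [apply C_differentiable_id|].
  apply (C_differentiable_inv (fun z => z - w)); [apply C_differentiable_minus_const|].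
  now apply circle_minus_neq_0.
- apply path_continuous_mult; [apply path_continuous_const|apply path_continuous_cis].
Qed.

(** The two Cauchy kernels on the circle of radius rad/2 differ by zeta (z - w) / ((zeta - z)(zeta -
    w)). Both points keep a distance of at least rad/4 from that circle, whence the factor 8/rad =
    (rad/2) / (rad/4)^2. *)
Lemma locally_lipschitz_at_0 f (rad : R) : (0 < rad)%R ->
  (forall z, (Cmod z < rad)%R -> C_differentiable f z) ->
  exists L : R, (0 <= L)%R /\ forall z w, (Cmod z <= rad / 4)%R -> (Cmod w <= rad / 4)%R ->
    (Cmod (f z - f w) <= L * Cmod (z - w))%R.
Proof.
intros HR Hf.
set (rho := (rad / 2)%R).
assert (Hrho : (0 <= rho < rad)%R) by (unfold rho; lra).
destruct (path_continuous_bounded (fun t => f (rho * cis t)) 0 1) as [M HM]; [lra| |].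
{ intros t _. now apply (path_continuous_on_circle f rad). }
assert (HM0 : (0 <= M)%R).
{ eapply Rle_trans; [apply Cmod_ge_0|apply (HM 0%R); lra]. }
exists (M * (8 / rad))%R. split.
{ apply Rmult_le_pos; trivial. apply Rlt_le, Rdiv_lt_0_compat; lra. }
intros z w Hz Hw.
assert (Hz' : (Cmod z < rho)%R) by (unfold rho; lra).
assert (Hw' : (Cmod w < rho)%R) by (unfold rho; lra).
rewrite <- (cauchy_formula f rad rho z), <- (cauchy_formula f rad rho w); trivial; try lra.
assert (Hcz : forall x, (Cmod x < rho)%R -> forall t, (0 <= t <= 1)%R -> path_continuous
  (fun t => f (rho * cis t) * (rho * cis t / (rho * cis t - x))) t).
{ intros x Hx t Ht. apply path_continuous_mult.
  - now apply (path_continuous_on_circle f rad).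
  - now apply path_continuous_cauchy_kernel. }
rewrite <- CInt_minus; try lra; try now apply Hcz.
replace (M * (8 / rad) * Cmod (z - w))%R with ((1 - 0) * (M * (8 / rad) * Cmod (z - w)))%R by ring.
apply Cmod_CInt_le; [lra| |].
{ intros t Ht. apply path_continuous_plus; [now apply Hcz|].
  apply path_continuous_opp. now apply Hcz. }
intros t Ht.
pose proof (circle_minus_neq_0 rho z t Hz') as Hz0.
pose proof (circle_minus_neq_0 rho w t Hw') as Hw0.
replace (f (rho * cis t) * (rho * cis t / (rho * cis t - z)) -
   f (rho * cis t) * (rho * cis t / (rho * cis t - w))) with
  (f (rho * cis t) * (rho * cis t / ((rho * cis t - z) * (rho * cis t - w))) * (z - w))
  by (field; tauto).
rewrite 2!Cmod_mult.
apply Rmult_le_compat_r; [apply Cmod_ge_0|].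
apply Rmult_le_compat; try apply Cmod_ge_0; [now apply HM|].
rewrite Cmod_div by now apply Cmult_neq_0.
rewrite Cmod_RtoC_cis, Cmod_mult by lra.
pose proof (Cmod_sub_lower (rho * cis t) z) as H1.
pose proof (Cmod_sub_lower (rho * cis t) w) as H2.
rewrite Cmod_RtoC_cis in H1, H2 by lra.
assert (E1 : (rad / 4 <= Cmod (rho * cis t - z))%R) by (unfold rho in *; lra).
assert (E2 : (rad / 4 <= Cmod (rho * cis t - w))%R) by (unfold rho in *; lra).
apply Rle_trans with (rho / (rad / 4 * (rad / 4)))%R.
- apply Rmult_le_compat_l; [lra|]. apply Rinv_le_contravar; [nra|].
  apply Rmult_le_compat; lra.
- right. unfold rho. field. lra.
Qed.

(** Integrate zeta / (zeta - z) = 1 + z/zeta + z^2/zeta^2 + z^3 / (zeta^2 (zeta - z)) against [f]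
    over |zeta| = rad/2. In the last term |zeta - z| >= rad/4, which gives 16/rad^3 = 1 /
    ((rad/4)(rad/2)^2). *)
Lemma taylor_order_2 f (rad : R) : (0 < rad)%R ->
  (forall z, (Cmod z < rad)%R -> C_differentiable f z) ->
  exists (a b : C) (K : R), (0 <= K)%R /\ forall z, (Cmod z <= rad / 4)%R ->
    (Cmod (f z - (f 0 + a * z + b * (z * z))) <= K * (Cmod z * Cmod z * Cmod z))%R.
Proof.
intros HR Hf.
set (rho := (rad / 2)%R).
assert (Hrho : (0 <= rho < rad)%R) by (unfold rho; lra).
assert (Hrho0 : RtoC rho <> 0) by (intros E; apply RtoC_inj in E; unfold rho in E; lra).
assert (Hcf : forall t, (0 <= t <= 1)%R -> path_continuous (fun t => f (rho * cis t)) t).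
{ intros t _. now apply (path_continuous_on_circle f rad). }
destruct (path_continuous_bounded (fun t => f (rho * cis t)) 0 1) as [M HM]; trivial; [lra|].
assert (HM0 : (0 <= M)%R).
{ eapply Rle_trans; [apply Cmod_ge_0|apply (HM 0%R); lra]. }
assert (Hci : forall t, path_continuous (fun t => / (rho * cis t)) t).
{ intros t. apply (path_continuous_differentiable (fun z => / z)).
  - apply C_differentiable_Cinv. apply Cmult_neq_0; [trivial|apply cis_neq_0].
  - apply path_continuous_mult; [apply path_continuous_const|apply path_continuous_cis]. }
exists (CInt (fun t => f (rho * cis t) * / (rho * cis t)) 0 1),
 (CInt (fun t => f (rho * cis t) * (/ (rho * cis t) * / (rho * cis t))) 0 1),
 (M * (16 / (rad * rad * rad)))%R.
split.
{ apply Rmult_le_pos; trivial. apply Rlt_le, Rdiv_lt_0_compat; [lra|].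
  repeat apply Rmult_lt_0_compat; trivial. }
intros z Hz.
assert (Hz' : (Cmod z < rho)%R) by (unfold rho; lra).
assert (H0 : (Cmod 0 < rho)%R) by (rewrite Cmod_0; unfold rho; lra).
assert (Hck : forall x, (Cmod x < rho)%R -> forall t, (0 <= t <= 1)%R -> path_continuous
  (fun t => f (rho * cis t) * (rho * cis t / (rho * cis t - x))) t).
{ intros x Hx t Ht. apply path_continuous_mult; [now apply Hcf|].
  now apply path_continuous_cauchy_kernel. }
assert (Hc1 : forall t, (0 <= t <= 1)%R ->
  path_continuous (fun t => f (rho * cis t) * / (rho * cis t)) t).
{ intros t Ht. apply path_continuous_mult; [now apply Hcf|apply Hci]. }
assert (Hc2 : forall t, (0 <= t <= 1)%R ->
  path_continuous (fun t => f (rho * cis t) * (/ (rho * cis t) * / (rho * cis t))) t).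
{ intros t Ht. apply path_continuous_mult; [now apply Hcf|].
  apply path_continuous_mult; apply Hci. }
rewrite <- (cauchy_formula f rad rho z), <- (cauchy_formula f rad rho 0); trivial; try lra.
rewrite (Cmult_comm _ z), (Cmult_comm _ (z * z)).
rewrite <- !CInt_scal; trivial; try lra.
assert (Hs1 : forall t, (0 <= t <= 1)%R ->
  path_continuous (fun t => z * (f (rho * cis t) * / (rho * cis t))) t).
{ intros t Ht. apply path_continuous_mult; [apply path_continuous_const|now apply Hc1]. }
assert (Hs2 : forall t, (0 <= t <= 1)%R ->
  path_continuous (fun t => z * z * (f (rho * cis t) * (/ (rho * cis t) * / (rho * cis t)))) t).
{ intros t Ht. apply path_continuous_mult; [apply path_continuous_const|now apply Hc2]. }
assert (Hs3 : forall t, (0 <= t <= 1)%R -> path_continuous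
  (fun t => f (rho * cis t) * (rho * cis t / (rho * cis t - 0)) +
    z * (f (rho * cis t) * / (rho * cis t))) t).
{ intros t Ht. apply path_continuous_plus; [now apply Hck|now apply Hs1]. }
rewrite <- CInt_plus; [|lra|now apply Hck|exact Hs1].
rewrite <- CInt_plus; [|lra|exact Hs3|exact Hs2].
rewrite <- CInt_minus; [|lra|now apply Hck|].
2:{ intros t Ht. apply path_continuous_plus; [now apply Hs3|now apply Hs2]. }
match goal with |- (_ <= ?x)%R => replace x with ((1 - 0) * x)%R by ring end.
apply Cmod_CInt_le; [lra| |].
{ intros t Ht. apply path_continuous_plus; [now apply Hck|].
  apply path_continuous_opp, path_continuous_plus; [now apply Hs3|now apply Hs2]. }
intros t Ht.
pose proof (circle_minus_neq_0 rho z t Hz') as Hz0.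
pose proof (cis_neq_0 t) as He0.
match goal with |- (Cmod ?x <= _)%R => replace x with
  (f (rho * cis t) * ((z * z * z) / ((rho * cis t - z) * (rho * cis t * (rho * cis t))))) end.
2:{ field. repeat split; trivial. }
rewrite Cmod_mult, Rmult_assoc.
apply Rmult_le_compat; try apply Cmod_ge_0; [now apply HM|].
rewrite Cmod_div by (repeat apply Cmult_neq_0; trivial).
rewrite !Cmod_mult, !Cmod_cis, !Cmod_R, !Rabs_pos_eq, !Rmult_1_r by lra.
pose proof (Cmod_sub_lower (rho * cis t) z) as H1.
rewrite Cmod_RtoC_cis in H1 by lra.
assert (E1 : (rad / 4 <= Cmod (rho * cis t - z))%R) by (unfold rho in *; lra).
rewrite (Rmult_comm (16 / _)). apply Rmult_le_compat_l.
{ repeat apply Rmult_le_pos; apply Cmod_ge_0. }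
replace (16 / (rad * rad * rad))%R with (/ (rad / 4 * (rho * rho)))%R by (unfold rho; field; lra).
assert (0 < rho)%R by (unfold rho; lra).
apply Rinv_le_contravar; [repeat apply Rmult_lt_0_compat; lra|].
apply Rmult_le_compat_r; nra.
Qed.

(** Away from tau the quotient f(z)/(z - tau) is visibly differentiable. At tau it takes the first
    Taylor coefficient as value, and the second one is then its derivative. *)
Lemma zero_factorisation f (rad : R) tau :
  (forall z, (Cmod z < rad)%R -> C_differentiable f z) ->
  (Cmod tau < rad)%R -> f tau = 0 ->
  exists q : C -> C, forall z, (Cmod z < rad)%R ->
    f z = (z - tau) * q z /\ C_differentiable q z.
Proof.
intros Hf Htau H0.
destruct (taylor_order_2 (fun u => f (tau + u)) (rad - Cmod tau)) as [a [b [K [HK HT]]]].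
{ lra. }
{ intros u Hu. apply (C_differentiable_comp (fun u => tau + u) f).
  - apply C_differentiable_plus; [apply C_differentiable_const|apply C_differentiable_id].
  - apply Hf. eapply Rle_lt_trans; [apply Cmod_triangle|]. lra. }
set (q := fun z => if excluded_middle_informative (z = tau) then a else f z / (z - tau)).
assert (Hq : forall z, z <> tau -> q z = f z / (z - tau)).
{ intros z Hz. unfold q. now destruct (excluded_middle_informative (z = tau)). }
assert (Hqt : q tau = a).
{ unfold q. now destruct (excluded_middle_informative (tau = tau)). }
assert (Hsub : forall z, z <> tau -> z - tau <> 0).
{ intros z Hz E. apply Hz. replace z with ((z - tau) + tau) by ring. rewrite E. ring. }
exists q. intros z Hz. split.
- destruct (classic (z = tau)) as [->|Hn].
  + rewrite H0. ring.
  + rewrite Hq by trivial. field. now apply Hsub.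
- destruct (classic (z = tau)) as [->|Hn].
  + exists b. intros eps He.
    (* The expansion holds up to distance (rad - |tau|)/4, and its cubic remainder, divided by y -
       tau, is at most K r^2 <= eps r with r = |y - tau|. K + 1 replaces K because K may be zero. *)
    exists (Rmin ((rad - Cmod tau) / 4) (eps / (K + 1))). split.
    { apply Rmin_pos; [lra|]. apply Rdiv_lt_0_compat; lra. }
    intros y Hy. apply Rmin_Rgt_l in Hy. destruct Hy as [Hy1 Hy2].
    destruct (classic (y = tau)) as [->|Hyn].
    { replace (q tau - q tau - b * (tau - tau)) with (RtoC 0) by ring.
      rewrite Cmod_0. apply Rmult_le_pos; [lra|apply Cmod_ge_0]. }
    rewrite Hq, Hqt by trivial.
    specialize (HT (y - tau) ltac:(lra)).
    replace (tau + (y - tau)) with y in HT by ring.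
    replace (tau + 0) with tau in HT by ring. rewrite H0 in HT.
    specialize (Hsub y Hyn).
    assert (Hr : (0 < Cmod (y - tau))%R) by (now apply Cmod_gt_0).
    set (r := Cmod (y - tau)) in *.
    apply Rmult_le_reg_r with r; trivial. unfold r at 1. rewrite <- Cmod_mult.
    replace ((f y / (y - tau) - a - b * (y - tau)) * (y - tau)) with
      (f y - (0 + a * (y - tau) + b * ((y - tau) * (y - tau)))) by (field; trivial).
    eapply Rle_trans; [exact HT|].
    assert (K * r <= eps)%R.
    { apply Rle_trans with ((K + 1) * (eps / (K + 1)))%R.
      - apply Rmult_le_compat; lra.
      - right. field. lra. }
    replace (K * (r * r * r))%R with (K * r * r * r)%R by ring.
    repeat apply Rmult_le_compat_r; lra.
  + apply (C_differentiable_ext_loc (fun z => f z / (z - tau)) q z (Cmod (z - tau))).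
    * apply Cmod_gt_0. now apply Hsub.
    * intros y Hy. symmetry. apply Hq. intros ->. rewrite Cmod_sub_sym in Hy. lra.
    * apply C_differentiable_mult; [now apply Hf|].
      apply (C_differentiable_inv (fun z => z - tau)); [apply C_differentiable_minus_const|].
      now apply Hsub.
Qed.

(** On the unit circle 1 - conj w zeta = zeta conj (zeta - w), so both fractions acquire the
    denominator |zeta - w|^2 and the numerators add up to 1 - |w|^2. *)
Lemma poisson_kernel_eq w t : (Cmod w < 1)%R ->
  cis t / (cis t - w) + Cconj w * cis t / (1 - Cconj w * cis t) =
  RtoC ((1 - Cmod w ^ 2) / Cmod (cis t - w) ^ 2).
Proof.
intros Hw.
assert (H1 : cis t - w <> 0).
{ pose proof (circle_minus_neq_0 1 w t Hw) as H. contradict H. rewrite <- H. ring. }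
assert (H2 : Cconj (cis t - w) <> 0).
{ apply Cmod_gt_0. rewrite Cmod_conj. now apply Cmod_gt_0. }
assert (H3 : 1 - Cconj w * cis t = cis t * Cconj (cis t - w)).
{ rewrite <- (cis_conj t). rewrite Cminus_conj. ring. }
assert (H4 : Cmod (cis t - w) <> 0%R).
{ apply Cmod_gt_0 in H1. lra. }
rewrite H3, RtoC_div, RtoC_minus, !Cmod2_conj.
2:{ now apply pow_nonzero. }
pose proof (cis_neq_0 t) as He.
replace (cis t / (cis t - w) + Cconj w * cis t / (cis t * Cconj (cis t - w)))
 with ((cis t * Cconj (cis t - w) + Cconj w * (cis t - w)) /
   ((cis t - w) * Cconj (cis t - w))) by (field; tauto).
f_equal. rewrite <- H3. ring.
Qed.

(** The function [H] vanishes at 0, so its Cauchy integral at 0 can be added to that of [h] at w for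
    free. The sum of the two kernels is the Poisson kernel, which is real and positive, and so the
    real part passes under the integral. *)
Lemma Re_nonneg_of_boundary h (rad : R) : (1 < rad)%R ->
  (forall z, (Cmod z < rad)%R -> C_differentiable h z) ->
  (forall t, (0 <= Re (h (cis t)))%R) ->
  forall w, (Cmod w < 1)%R -> (0 <= Re (h w))%R.
Proof.
intros HR Hh Hb w Hw. pose proof (Cmod_ge_0 w) as Hw0.
set (H := fun z => h z * (Cconj w * z / (1 - Cconj w * z))).
(* For w <> 0 the pole of [H] has modulus 1/|w|, and 2/(1 + |w|) lies strictly between 1 and
   1/|w|. *)
set (R' := Rmin rad (2 / (1 + Cmod w))).
assert (HR' : (1 < R')%R).
{ apply Rmin_glb_lt; trivial. apply Rmult_lt_reg_r with (1 + Cmod w)%R; [lra|].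
  unfold Rdiv. rewrite Rmult_assoc, Rinv_l; lra. }
assert (Hne : forall z, (Cmod z < R')%R -> 1 - Cconj w * z <> 0).
{ intros z Hz E.
  assert (E1 : Cconj w * z = 1).
  { replace (Cconj w * z) with (1 - (1 - Cconj w * z)) by ring. rewrite E. ring. }
  apply (f_equal Cmod) in E1. rewrite Cmod_mult, Cmod_conj, Cmod_1 in E1.
  assert (Hz2 : (Cmod z < 2 / (1 + Cmod w))%R) by (eapply Rlt_le_trans; [exact Hz|apply Rmin_r]).
  apply (Rmult_lt_compat_r (1 + Cmod w)) in Hz2; [|lra].
  unfold Rdiv in Hz2. rewrite Rmult_assoc, Rinv_l in Hz2 by lra.
  assert (1 <= Cmod z)%R.
  { pose proof (Cmod_ge_0 z). nra. }
  lra. }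
assert (HH : forall z, (Cmod z < R')%R -> C_differentiable H z).
{ intros z Hz. assert (Hl : C_differentiable (fun z => Cconj w * z) z).
  { apply C_differentiable_mult; [apply C_differentiable_const|apply C_differentiable_id]. }
  apply C_differentiable_mult.
  - apply Hh. eapply Rlt_le_trans; [exact Hz|apply Rmin_l].
  - apply C_differentiable_mult; trivial.
    apply (C_differentiable_inv (fun z => 1 - Cconj w * z)); [|now apply Hne].
    apply C_differentiable_plus; [apply C_differentiable_const|].
    apply (C_differentiable_ext_loc (fun z => (-(1)) * (Cconj w * z)) _ z 1); [lra| |].
    + intros y _. ring.
    + apply C_differentiable_mult; [apply C_differentiable_const|trivial]. }
assert (Hc1 : forall t, path_continuous
  (fun t => h (1 * cis t) * (1 * cis t / (1 * cis t - w))) t).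
{ intros t. apply path_continuous_mult.
  - apply (path_continuous_on_circle h rad); trivial; lra.
  - now apply path_continuous_cauchy_kernel. }
assert (Hc2 : forall t, path_continuous
  (fun t => H (1 * cis t) * (1 * cis t / (1 * cis t - 0))) t).
{ intros t. apply path_continuous_mult.
  - apply (path_continuous_on_circle H R'); trivial; lra.
  - apply path_continuous_cauchy_kernel. rewrite Cmod_0; lra. }
assert (HP : forall t, h (1 * cis t) * (1 * cis t / (1 * cis t - w)) +
    H (1 * cis t) * (1 * cis t / (1 * cis t - 0)) =
    h (cis t) * RtoC ((1 - Cmod w ^ 2) / Cmod (cis t - w) ^ 2)).
{ intros t. rewrite <- poisson_kernel_eq by trivial. unfold H. rewrite !Cmult_1_l.
  pose proof (circle_minus_neq_0 1 w t Hw) as H1. rewrite Cmult_1_l in H1.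
  assert (1 - Cconj w * cis t <> 0) by (apply Hne; rewrite Cmod_cis; lra).
  pose proof (cis_neq_0 t).
  assert (cis t - 0 <> 0) by (now replace (cis t - 0) with (cis t) by ring).
  field. tauto. }
assert (HC : h w = CInt (fun t => h (1 * cis t) * (1 * cis t / (1 * cis t - w)) +
  H (1 * cis t) * (1 * cis t / (1 * cis t - 0))) 0 1).
{ rewrite CInt_plus by (trivial; lra).
  rewrite (cauchy_formula h rad 1 w), (cauchy_formula H R' 1 0);
    trivial; try lra.
  - unfold H, Cdiv. ring.
  - rewrite Cmod_0. lra. }
rewrite HC. unfold CInt.
match goal with |- (0 <= Re (RInt (fun t => Re (@?F t)) _ _, _))%R =>
  change (0 <= RInt (fun t => Re (F t)) 0 1)%R end.
cbv beta. apply RInt_ge_0; [lra| |].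
- apply (ex_RInt_continuous (V := R_CompleteNormedModule)). intros t _.
  exact (proj1 (path_continuous_plus _ _ t (Hc1 t) (Hc2 t))).
- intros t Ht. rewrite HP.
  replace (Re (h (cis t) * RtoC ((1 - Cmod w ^ 2) / Cmod (cis t - w) ^ 2))%C)
   with (Re (h (cis t)) * ((1 - Cmod w ^ 2) / Cmod (cis t - w) ^ 2))%R
   by (unfold Re; simpl; ring).
  apply Rmult_le_pos; [apply Hb|].
  apply Rlt_le, Rdiv_lt_0_compat; [nra|].
  apply pow_lt, Cmod_gt_0.
  pose proof (circle_minus_neq_0 1 w t Hw) as H1. now rewrite Cmult_1_l in H1.
Qed.

(** * The vector field *)

Lemma Cauchy_seq_converges (z : nat -> C) (b : nat -> R) :
  is_lim_seq b 0%R -> (forall n m, (Cmod (z (n + m)%nat - z n) <= b n)%R) ->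
  exists l, forall eps : R, (0 < eps)%R -> exists N, forall n, (N <= n)%nat ->
    (Cmod (z n - l) < eps)%R.
Proof.
intros Hb Hz.
assert (HN : forall eps : posreal, exists N, forall n m, (N <= n)%nat -> (N <= m)%nat ->
  (Cmod (z n - z m) < eps)%R).
{ intros eps. apply is_lim_seq_spec in Hb.
  destruct (Hb (pos_div_2 eps)) as [N HN]. simpl in HN.
  exists N. intros n m Hn Hm. specialize (HN N (le_n N)).
  rewrite Rminus_0_r in HN. apply Rabs_def2 in HN.
  pose proof (Hz N (n - N)%nat) as H1. pose proof (Hz N (m - N)%nat) as H2.
  replace (N + (n - N))%nat with n in H1 by lia.
  replace (N + (m - N))%nat with m in H2 by lia.
  replace (z n - z m) with ((z n - z N) - (z m - z N)) by ring.
  eapply Rle_lt_trans; [apply Cmod_triangle|]. rewrite Cmod_opp. lra. }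
assert (H1 : ex_finite_lim_seq (fun n => Re (z n))).
{ apply ex_lim_seq_cauchy_corr. intros eps. destruct (HN eps) as [N H].
  exists N. intros n m Hn Hm. eapply Rle_lt_trans; [|apply (H n m Hn Hm)].
  apply (re_le_Cmod (z n - z m)). }
assert (H2 : ex_finite_lim_seq (fun n => Im (z n))).
{ apply ex_lim_seq_cauchy_corr. intros eps. destruct (HN eps) as [N H].
  exists N. intros n m Hn Hm. eapply Rle_lt_trans; [|apply (H n m Hn Hm)].
  eapply Rle_trans; [|apply Rmax_Cmod]. apply Rmax_r. }
destruct H1 as [x Hx]. destruct H2 as [y Hy].
exists (x, y). intros eps He.
apply is_lim_seq_spec in Hx. apply is_lim_seq_spec in Hy.
destruct (Hx (pos_div_2 (mkposreal eps He))) as [N1 HN1].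
destruct (Hy (pos_div_2 (mkposreal eps He))) as [N2 HN2].
exists (N1 + N2)%nat. intros n Hn.
specialize (HN1 n ltac:(lia)). specialize (HN2 n ltac:(lia)). simpl in HN1, HN2.
eapply Rle_lt_trans; [apply Cmod_le_Re_Im|].
change (Rabs (Re (z n) - x) + Rabs (Im (z n) - y) < eps)%R. lra.
Qed.

Lemma contraction_fixed_point (T : C -> C) (d : R) : (0 <= d)%R ->
  (forall z, (Cmod z <= d)%R -> (Cmod (T z) <= d)%R) ->
  (forall z w, (Cmod z <= d)%R -> (Cmod w <= d)%R ->
     (Cmod (T z - T w) <= / 2 * Cmod (z - w))%R) ->
  exists z, (Cmod z <= d)%R /\ T z = z.
Proof.
intros Hd Hball Hlip.
set (z := fix z n := match n with O => RtoC 0 | S m => T (z m) end).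
assert (Hz : forall n, (Cmod (z n) <= d)%R).
{ induction n; simpl; [rewrite Cmod_0; trivial|now apply Hball]. }
(* Applying [T] n times shrinks the distance from z m to z 0 by the factor 2^-n, uniformly in m. *)
destruct (Cauchy_seq_converges z (fun n => 2 * d * (/ 2) ^ n)%R) as [l Hl].
{ replace (Finite 0) with (Rbar_mult (2 * d)%R 0%R) by (simpl; f_equal; ring).
  apply is_lim_seq_scal_l, is_lim_seq_geom. rewrite Rabs_pos_eq; lra. }
{ intros n m. induction n.
  - simpl. eapply Rle_trans; [apply Cmod_triangle|]. rewrite Cmod_opp, Cmod_0.
    specialize (Hz m). lra.
  - simpl. eapply Rle_trans; [now apply Hlip|]. simpl in IHn. lra. }
assert (Hld : (Cmod l <= d)%R).
{ apply Rnot_lt_le. intros Hn. destruct (Hl (Cmod l - d)%R ltac:(lra)) as [N HN].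
  specialize (HN N (le_n N)). rewrite Cmod_sub_sym in HN.
  pose proof (Cmod_sub_lower l (z N)). specialize (Hz N). lra. }
exists l. split; trivial.
assert (H0 : Cmod (T l - l) = 0%R).
{ apply Rle_antisym; [|apply Cmod_ge_0]. apply Rnot_lt_le. intros Hn.
  destruct (Hl (Cmod (T l - l) / 2)%R ltac:(lra)) as [N HN].
  pose proof (HN N (le_n N)) as H1. pose proof (HN (S N) ltac:(lia)) as H2. simpl in H2.
  pose proof (Hlip l (z N) Hld (Hz N)) as H3. rewrite Cmod_sub_sym in H1.
  pose proof (Cmod_triangle (T l - T (z N)) (T (z N) - l)) as H4.
  replace (T l - T (z N) + (T (z N) - l)) with (T l - l) in H4 by ring.
  lra. }
apply Cmod_eq_0 in H0. replace (T l) with ((T l - l) + l) by ring. rewrite H0. ring.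
Qed.

(** On the unit circle conj tau c - 1 = - c conj (c - tau). The case tau = 1 rewrites (c - 1)^2, so
    the same identity serves the numerator and the denominator of the Berkson-Porta quotient. *)
Lemma unit_circle_factor (c tau : C) : c * Cconj c = 1 ->
  (c - tau) * (Cconj tau * c - 1) = - (c * ((c - tau) * Cconj (c - tau))).
Proof.
intros Hc. rewrite Cminus_conj.
replace (c * ((c - tau) * (Cconj c - Cconj tau))) with
  ((c - tau) * (c * Cconj c - c * Cconj tau)) by ring.
rewrite Hc. ring.
Qed.

(** Only the argument of [p] is dilated: the factor (z - 1)^2 keeps its form on the unit circle. At
    r = 1 this is [rotated_field]. *)
Definition scaled_field (p : C -> C) (k r : R) (z : C) : C :=
  (z - 1) * (z - 1) * p (r * z) - Ci * k * z.

(* On |z| = 1 both (z-1)^2 and (z-tau)(conj tau z - 1) are negative multiples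
   of z and -ikz contributes an imaginary quotient. *)
Lemma Re_quotient_nonneg_on_circle (p : C -> C) (k r : R) (tau q c : C) :
  (0 <= Re (p (r * c)%C))%R -> c * Cconj c = 1 -> c - tau <> 0 ->
  scaled_field p k r c = (c - tau) * q ->
  (0 <= Re (q / (Cconj tau * c - 1)))%R.
Proof.
intros Hp Hc Hn Hq.
assert (Hc0 : c <> 0).
{ intros E. rewrite E, Cmult_0_l in Hc. apply RtoC_inj in Hc. lra. }
assert (Hn' : Cconj (c - tau) <> 0).
{ apply Cmod_gt_0. rewrite Cmod_conj. now apply Cmod_gt_0. }
pose proof (unit_circle_factor c tau Hc) as E1.
pose proof (unit_circle_factor c 1 Hc) as E2.
replace (Cconj 1) with (RtoC 1) in E2 by (unfold Cconj, RtoC; simpl; f_equal; ring).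
rewrite Cmult_1_l in E2.
assert (Hd : Cconj tau * c - 1 <> 0).
{ intros E. rewrite E, Cmult_0_r in E1.
  assert (c * ((c - tau) * Cconj (c - tau)) = 0).
  { replace (c * ((c - tau) * Cconj (c - tau))) with
      (- - (c * ((c - tau) * Cconj (c - tau)))) by ring. rewrite <- E1. ring. }
  revert H. repeat apply Cmult_neq_0; trivial. }
replace (q / (Cconj tau * c - 1)) with
  (RtoC (/ Cmod (c - tau) ^ 2) * (RtoC (Cmod (c - 1) ^ 2) * p (r * c) + Ci * k)).
- replace (Re _) with (/ Cmod (c - tau) ^ 2 * (Cmod (c - 1) ^ 2 * Re (p (r * c)%C)))%R.
  + apply Rmult_le_pos.
    * apply Rlt_le, Rinv_0_lt_compat, pow_lt. now apply Cmod_gt_0.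
    * apply Rmult_le_pos; trivial. apply pow_le, Cmod_ge_0.
  + unfold Re. simpl. ring.
- assert (Hm : Cmod (c - tau) <> 0%R) by (apply Cmod_gt_0 in Hn; lra).
  rewrite RtoC_inv by now apply pow_nonzero.
  rewrite !Cmod2_conj.
  replace (q / (Cconj tau * c - 1)) with
    (scaled_field p k r c / ((c - tau) * (Cconj tau * c - 1))) by (rewrite Hq; field; tauto).
  unfold scaled_field. rewrite E1, E2. field. tauto.
Qed.

Lemma scaled_field_differentiable (p : C -> C) (k r : R) (z : C) :
  C_differentiable p (r * z) -> C_differentiable (scaled_field p k r) z.
Proof.
intros Hp. unfold scaled_field.
apply C_differentiable_plus.
- apply C_differentiable_mult.
  + apply C_differentiable_mult; apply C_differentiable_minus_const.
  + apply (C_differentiable_comp (fun z => r * z) p); trivial.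
    apply C_differentiable_mult; [apply C_differentiable_const|apply C_differentiable_id].
- apply (C_differentiable_ext_loc (fun z => - (Ci * k) * z) _ z 1); [lra| |].
  + intros y _. ring.
  + apply C_differentiable_mult; [apply C_differentiable_const|apply C_differentiable_id].
Qed.

Lemma moebius_denominator (tau z : C) : (Cmod tau < 1)%R -> (Cmod tau * Cmod z < 1)%R ->
  Cconj tau * z - 1 <> 0.
Proof.
intros Ht Hz E.
assert (E1 : Cconj tau * z = 1).
{ replace (Cconj tau * z) with ((Cconj tau * z - 1) + 1) by ring. rewrite E. ring. }
apply (f_equal Cmod) in E1. rewrite Cmod_mult, Cmod_conj, Cmod_1 in E1. lra.
Qed.

Lemma moebius_quotient_differentiable (q : C -> C) (tau z : C) :
  C_differentiable q z -> Cconj tau * z - 1 <> 0 ->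
  C_differentiable (fun z => q z / (Cconj tau * z - 1)) z.
Proof.
intros Hq Hz. apply C_differentiable_mult; trivial.
apply (C_differentiable_inv (fun z => Cconj tau * z - 1)); trivial.
apply C_differentiable_plus; [|apply C_differentiable_const].
apply C_differentiable_mult; [apply C_differentiable_const|apply C_differentiable_id].
Qed.

(** The product is |D|^2 h. It turns the sign of a quotient into the sign of numerator times
    conjugate denominator, a form in which the limit r -> 1 needs no division. *)
Lemma Re_mul_conj_of_quotient (h D : C) :
  (0 <= Re h)%R -> (0 <= Re (D * h * Cconj D))%R.
Proof.
intros Hh. replace (D * h * Cconj D) with (RtoC (Cmod D ^ 2) * h).
- replace (Re _) with (Cmod D ^ 2 * Re h)%R by (unfold Re; simpl; ring).
  apply Rmult_le_pos; trivial. apply pow_le, Cmod_ge_0.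
- rewrite Cmod2_conj. ring.
Qed.

(* For r < 1 the field extends holomorphically across the unit circle. *)
Lemma scaled_field_half_plane (p : C -> C) (k r : R) (tau : C) :
  (forall z, (Cmod z < 1)%R -> C_differentiable p z) ->
  (forall z, (Cmod z < 1)%R -> (0 <= Re (p z))%R) ->
  (0 < r < 1)%R -> (Cmod tau < 1)%R -> scaled_field p k r tau = 0 ->
  forall z, (Cmod z < 1)%R ->
    (0 <= Re (scaled_field p k r z * Cconj ((z - tau) * (Cconj tau * z - 1))))%R.
Proof.
intros Hp Hre Hr Htau H0 z Hz.
pose proof (Cmod_ge_0 tau) as Ht0.
assert (Hir : (1 < / r)%R) by (rewrite <- Rinv_1; apply Rinv_lt_contravar; lra).
(* The map z -> p(rz) is holomorphic for |z| < 1/r, a disc that contains the closed unit disc. *)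
destruct (zero_factorisation (scaled_field p k r) (/ r) tau) as [q Hq]; trivial; try lra.
{ intros x Hx. apply scaled_field_differentiable, Hp.
  rewrite Cmod_mult, Cmod_R, Rabs_pos_eq by lra.
  apply (Rmult_lt_compat_l r) in Hx; [|lra]. rewrite Rinv_r in Hx; lra. }
set (h := fun z => q z / (Cconj tau * z - 1)).
set (R' := Rmin (/ r) (2 / (1 + Cmod tau))).
assert (HR' : (1 < R')%R).
{ apply Rmin_glb_lt; trivial. apply Rmult_lt_reg_r with (1 + Cmod tau)%R; [lra|].
  unfold Rdiv. rewrite Rmult_assoc, Rinv_l; lra. }
assert (Hne : forall x, (Cmod x < R')%R -> Cconj tau * x - 1 <> 0).
{ intros x Hx. apply moebius_denominator; trivial.
  assert (Hx2 : (Cmod x < 2 / (1 + Cmod tau))%R) by (eapply Rlt_le_trans; [exact Hx|apply Rmin_r]).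
  apply (Rmult_lt_compat_r (1 + Cmod tau)) in Hx2; [|lra].
  unfold Rdiv in Hx2. rewrite Rmult_assoc, Rinv_l in Hx2 by lra.
  pose proof (Cmod_ge_0 x). nra. }
assert (Hh : (0 <= Re (h z))%R).
{ apply (Re_nonneg_of_boundary h R'); trivial.
  - intros x Hx. apply moebius_quotient_differentiable; [|now apply Hne].
    apply Hq. eapply Rlt_le_trans; [exact Hx|apply Rmin_l].
  - intros t. apply (Re_quotient_nonneg_on_circle p k r).
    + apply Hre. rewrite Cmod_mult, Cmod_cis, Cmod_R, Rabs_pos_eq; lra.
    + apply cis_conj.
    + pose proof (circle_minus_neq_0 1 tau t Htau) as H1. now rewrite Cmult_1_l in H1.
    + apply Hq. rewrite Cmod_cis. lra. }
assert (HzR : (Cmod z < R')%R) by lra.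
replace (scaled_field p k r z) with ((z - tau) * (Cconj tau * z - 1) * h z).
- now apply Re_mul_conj_of_quotient.
- rewrite (proj1 (Hq z ltac:(lra))). unfold h. field. now apply Hne.
Qed.

Definition zero_map (p : C -> C) (k r : R) (z : C) : C :=
  (z - 1) * (z - 1) * p (r * z) / (Ci * k).

Lemma Ci_mult_neq_0 (k : R) : k <> 0%R -> Ci * k <> 0.
Proof.
intros Hk. apply Cmod_gt_0. rewrite Cmod_mult, Cmod_Ci, Cmod_R, Rmult_1_l.
now apply Rabs_pos_lt.
Qed.

Lemma zero_map_fixed_iff (p : C -> C) (k r : R) (z : C) : k <> 0%R ->
  zero_map p k r z = z <-> scaled_field p k r z = 0.
Proof.
intros Hk. apply Ci_mult_neq_0 in Hk. unfold zero_map, scaled_field.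
split; intros H.
- rewrite <- H at 4. field. split; intros E; apply Hk; rewrite E; ring.
- replace ((z - 1) * (z - 1) * p (r * z)) with
    (((z - 1) * (z - 1) * p (r * z) - Ci * k * z) + Ci * k * z) by ring.
  rewrite H. field. split; intros E; apply Hk; rewrite E; ring.
Qed.

(** * Zeros of the scaled fields for large |k| and their dependence on r *)

Section Zero.

Variables (p : C -> C) (L d k : R).
Hypothesis L_nonneg : (0 <= L)%R.
Hypothesis p_lipschitz : forall z w, (Cmod z <= 1 / 4)%R -> (Cmod w <= 1 / 4)%R ->
  (Cmod (p z - p w) <= L * Cmod (z - w))%R.
Hypothesis d_bound : (0 < d <= 1 / 8)%R.
Let M := (Cmod (p 0) + L)%R.
(** [M] bounds |p| on the disc of radius 1/4. Mapping the ball of radius d into itself takes 2M <= d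
    |k|, and the ratio 1/2 takes 3M + 2L <= |k|/2. The threshold covers both with room to spare, and
    the summand 1 forces k <> 0 even if M = L = 0. *)
Hypothesis k_large : (4 * (3 * M + 2 * L + 1) / d < Rabs k)%R.

Lemma p_bound_nonneg : (0 <= M)%R.
Proof. unfold M. pose proof (Cmod_ge_0 (p 0)). lra. Qed.

Lemma large_k_lower_bound : (4 * (3 * M + 2 * L + 1) < d * Rabs k)%R.
Proof.
apply (Rmult_lt_compat_l d) in k_large; [|lra].
replace (d * (4 * (3 * M + 2 * L + 1) / d))%R with (4 * (3 * M + 2 * L + 1))%R
  in k_large by (field; lra). exact k_large.
Qed.

Lemma large_k_Rabs_pos : (0 < Rabs k)%R.
Proof. pose proof large_k_lower_bound. pose proof p_bound_nonneg. nra. Qed.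

Lemma large_k_neq_0 : k <> 0%R.
Proof. intros E. pose proof large_k_Rabs_pos as H. rewrite E, Rabs_R0 in H. lra. Qed.

Lemma Cmod_p_scaled_le (r : R) z : (0 <= r <= 1)%R -> (Cmod z <= d)%R ->
  (Cmod (r * z) <= 1 / 4)%R /\ (Cmod (p (r * z)%C) <= M)%R.
Proof.
intros Hr Hz. pose proof (Cmod_ge_0 z).
assert (H1 : (Cmod (r * z) <= 1 / 4)%R).
{ rewrite Cmod_mult, Cmod_R, Rabs_pos_eq by lra. nra. }
split; trivial.
replace (p (r * z)) with ((p (r * z) - p 0) + p 0) by ring.
eapply Rle_trans; [apply Cmod_triangle|].
assert (H2 : (Cmod (p (r * z)%C - p 0) <= L * Cmod (r * z - 0))%R).
{ apply p_lipschitz; trivial. rewrite Cmod_0. lra. }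
replace (r * z - 0) with (r * z) in H2 by ring. unfold M. nra.
Qed.

Lemma Cmod_minus_1_sqr_le (z : C) : (Cmod z <= d)%R -> (Cmod ((z - 1) * (z - 1)) <= 2)%R.
Proof.
intros Hz. rewrite Cmod_mult.
assert (Cmod (z - 1) <= 9 / 8)%R.
{ eapply Rle_trans; [apply Cmod_triangle|]. rewrite Cmod_opp, Cmod_1. lra. }
pose proof (Cmod_ge_0 (z - 1)). nra.
Qed.

Lemma Cmod_div_Ci_k (x : C) : Cmod (x / (Ci * k)) = (Cmod x / Rabs k)%R.
Proof.
rewrite Cmod_div by (apply Ci_mult_neq_0, large_k_neq_0).
now rewrite Cmod_mult, Cmod_Ci, Cmod_R, Rmult_1_l.
Qed.

Lemma zero_map_ball (r : R) z : (0 <= r <= 1)%R ->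
  (Cmod z <= d)%R -> (Cmod (zero_map p k r z) <= d)%R.
Proof.
intros Hr Hz. unfold zero_map. rewrite Cmod_div_Ci_k.
pose proof large_k_Rabs_pos. pose proof large_k_lower_bound. pose proof p_bound_nonneg.
apply Rmult_le_reg_r with (Rabs k); trivial.
unfold Rdiv. rewrite Rmult_assoc, Rinv_l, Rmult_1_r by lra.
rewrite Cmod_mult.
apply Rle_trans with (2 * M)%R; [|lra].
apply Rmult_le_compat; try apply Cmod_ge_0.
- now apply Cmod_minus_1_sqr_le.
- now apply Cmod_p_scaled_le.
Qed.

(** The numerators are compared through (z - 1)^2 - (w - 1)^2 = (z - w)(z + w - 2): the change of
    the square costs 3M, the change of [p] costs 2L. The ratio does not depend on r, which is what
    makes the fixed point continuous in r. *)
Lemma zero_map_contraction (r : R) z w : (0 <= r <= 1)%R ->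
  (Cmod z <= d)%R -> (Cmod w <= d)%R ->
  (Cmod (zero_map p k r z - zero_map p k r w) <= / 2 * Cmod (z - w))%R.
Proof.
intros Hr Hz Hw.
pose proof large_k_Rabs_pos. pose proof large_k_lower_bound. pose proof p_bound_nonneg.
pose proof (Ci_mult_neq_0 k large_k_neq_0) as Hk.
replace (zero_map p k r z - zero_map p k r w) with
  (((z - w) * (z + w - 2) * p (r * z) + (w - 1) * (w - 1) * (p (r * z) - p (r * w)))
    / (Ci * k)).
2:{ unfold zero_map. field. split; intros E; apply Hk; rewrite E; ring. }
rewrite Cmod_div_Ci_k.
apply Rmult_le_reg_r with (Rabs k); trivial.
unfold Rdiv. rewrite Rmult_assoc, Rinv_l, Rmult_1_r by lra.
eapply Rle_trans; [apply Cmod_triangle|].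
destruct (Cmod_p_scaled_le r z Hr Hz) as [Hrz Hpz].
destruct (Cmod_p_scaled_le r w Hr Hw) as [Hrw _].
assert (Hzw : (Cmod (z + w - 2) <= 3)%R).
{ eapply Rle_trans; [apply Cmod_triangle|].
  rewrite Cmod_opp, Cmod_R, Rabs_pos_eq by lra.
  pose proof (Cmod_triangle z w). lra. }
assert (Hpzw : (Cmod (p (r * z)%C - p (r * w)%C) <= L * Cmod (z - w))%R).
{ eapply Rle_trans; [now apply p_lipschitz|].
  replace (r * z - r * w) with (r * (z - w)) by ring.
  rewrite Cmod_mult, Cmod_R, Rabs_pos_eq by lra.
  apply Rmult_le_compat_l; trivial. pose proof (Cmod_ge_0 (z - w)). nra. }
rewrite (Cmod_mult ((w - 1) * (w - 1))), (Cmod_mult ((z - w) * _)), (Cmod_mult (z - w)).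
pose proof (Cmod_minus_1_sqr_le w Hw) as Hw1.
set (D := Cmod (z - w)) in *. assert (HD : (0 <= D)%R) by apply Cmod_ge_0.
apply Rle_trans with (D * 3 * M + 2 * (L * D))%R.
- apply Rplus_le_compat; apply Rmult_le_compat; trivial; try apply Cmod_ge_0.
  + apply Rmult_le_pos; trivial. apply Cmod_ge_0.
  + now apply Rmult_le_compat_l.
- replace (D * 3 * M + 2 * (L * D))%R with ((3 * M + 2 * L) * D)%R by ring.
  replace (/ 2 * D * Rabs k)%R with (/ 2 * Rabs k * D)%R by ring.
  apply Rmult_le_compat_r; trivial. nra.
Qed.

Lemma scaled_field_zero (r : R) : (0 <= r <= 1)%R ->
  exists tau, (Cmod tau <= d)%R /\ zero_map p k r tau = tau.
Proof.
intros Hr. apply contraction_fixed_point; [lra| |].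
- intros z Hz. now apply zero_map_ball.
- intros z w Hz Hw. now apply zero_map_contraction.
Qed.

Hypothesis p_differentiable : forall z, (Cmod z < 1)%R -> C_differentiable p z.
Hypothesis p_Re : forall z, (Cmod z < 1)%R -> (0 <= Re (p z))%R.

(* The approximation r = 1 / (1 + s^2) makes the zeros tau s of the scaled
   fields a family continuous at s = 0, with r < 1 for every s <> 0. *)
Lemma scaled_field_half_plane_limit tau :
  (Cmod tau <= d)%R -> zero_map p k 1 tau = tau ->
  forall z, (Cmod z < 1)%R ->
    (0 <= Re (scaled_field p k 1 z * Cconj ((z - tau) * (Cconj tau * z - 1))))%R.
Proof.
intros Htau Hfix z Hz.
set (r := fun s : R => (/ (1 + s * s))%R).
assert (Hr : forall s, (0 < r s <= 1)%R).
{ intros s. unfold r. split.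
  - apply Rinv_0_lt_compat. nra.
  - rewrite <- Rinv_1 at 2. apply Rinv_le_contravar; nra. }
assert (Hr0 : r 0%R = 1%R) by (unfold r; field).
assert (Hex : exists ta : R -> C, forall s, (Cmod (ta s) <= d)%R /\
  zero_map p k (r s) (ta s) = ta s).
{ apply (choice (fun s t => (Cmod t <= d)%R /\ zero_map p k (r s) t = t)).
  intros s. apply scaled_field_zero. specialize (Hr s). lra. }
destruct Hex as [ta Hta].
assert (Hrc : path_continuous (fun s => RtoC (r s)) 0).
{ split; [|apply continuous_const].
  apply (ex_derive_continuous (V := R_NormedModule)). unfold r, RtoC. simpl.
  auto_derive. nra. }
assert (Hpc : forall x, (Cmod x < 1)%R -> path_continuous (fun s => p (r s * x)) 0).
{ intros x Hx. apply (path_continuous_differentiable p (fun s => r s * x)).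
  - apply p_differentiable. rewrite Hr0, Cmult_1_l. exact Hx.
  - apply path_continuous_mult; [trivial|apply path_continuous_const]. }
pose proof large_k_Rabs_pos as Hk0. pose proof (Ci_mult_neq_0 k large_k_neq_0) as Hk.
(* With T_s the zero map for r s, ta s - tau = (T_s (ta s) - T_s tau) + (T_s tau - T_1 tau). The
   first term is at most half of the left side and is absorbed; this doubles the bound 2/|k| of the
   second to 4/|k|. *)
assert (Hdist : forall s, (Cmod (ta s - tau) <=
  4 / Rabs k * Cmod (p (r s * tau)%C - p (r 0%R * tau)%C))%R).
{ intros s. destruct (Hta s) as [H1 H2]. specialize (Hr s).
  pose proof (zero_map_contraction (r s) (ta s) tau ltac:(lra) H1 Htau) as H3.
  rewrite H2 in H3.
  assert (H4 : (Cmod (zero_map p k (r s) tau - tau) <=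
    2 / Rabs k * Cmod (p (r s * tau)%C - p (r 0%R * tau)%C))%R).
  { rewrite Hr0. rewrite <- Hfix at 2.
    replace (zero_map p k (r s) tau - zero_map p k 1 tau) with
      ((tau - 1) * (tau - 1) * (p (r s * tau) - p (1 * tau)) / (Ci * k)).
    2:{ unfold zero_map. field. split; intros E; apply Hk; rewrite E; ring. }
    rewrite Cmod_div_Ci_k, Cmod_mult.
    unfold Rdiv. rewrite (Rmult_comm 2), !(Rmult_comm _ (/ Rabs k)), Rmult_assoc.
    apply Rmult_le_compat_l; [apply Rlt_le, Rinv_0_lt_compat; trivial|].
    apply Rmult_le_compat_r; [apply Cmod_ge_0|]. now apply Cmod_minus_1_sqr_le. }
  pose proof (Cmod_triangle (ta s - zero_map p k (r s) tau) (zero_map p k (r s) tau - tau)) as H5.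
  replace (ta s - zero_map p k (r s) tau + (zero_map p k (r s) tau - tau))
    with (ta s - tau) in H5 by ring.
  unfold Rdiv in *. lra. }
(* The family [ta] comes from the axiom of choice, so its value at 0 is known only through this
   estimate. *)
assert (Hta0 : ta 0%R = tau).
{ specialize (Hdist 0%R).
  replace (p (r 0%R * tau) - p (r 0%R * tau)) with (RtoC 0) in Hdist by ring.
  rewrite Cmod_0, Rmult_0_r in Hdist.
  assert (H0 : ta 0%R - tau = 0).
  { apply Cmod_eq_0. apply Rle_antisym; [trivial|apply Cmod_ge_0]. }
  replace (ta 0%R) with ((ta 0%R - tau) + tau) by ring. rewrite H0. ring. }
assert (Htac : path_continuous ta 0).
{ apply path_continuous_eps. intros eps He.
  destruct (eps_of_path_continuous _ _ (Hpc tau ltac:(lra)) (eps * Rabs k / 4)%R) as [e [He0 H]].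
  { apply Rdiv_lt_0_compat; nra. }
  exists e. split; trivial. intros s Hs. specialize (H s Hs). rewrite Hta0.
  eapply Rle_lt_trans; [apply Hdist|].
  apply Rlt_le_trans with (4 / Rabs k * (eps * Rabs k / 4))%R.
  - apply Rmult_lt_compat_l; trivial. apply Rdiv_lt_0_compat; lra.
  - right. field. lra. }
assert (Hcj : path_continuous (fun s => Cconj (ta s)) 0).
{ split; [apply Htac|]. apply (continuous_opp (V := R_NormedModule)), Htac. }
set (N := fun s => scaled_field p k (r s) z * Cconj ((z - ta s) * (Cconj (ta s) * z - 1))).
assert (HN : path_continuous N 0).
{ unfold N. apply path_continuous_mult.
  - unfold scaled_field. apply path_continuous_plus; [|apply path_continuous_const].
    apply path_continuous_mult; [apply path_continuous_const|now apply Hpc].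
  - assert (Hd : path_continuous (fun s => (z - ta s) * (Cconj (ta s) * z - 1)) 0).
    { apply path_continuous_mult; apply path_continuous_plus.
      - apply path_continuous_const.
      - now apply path_continuous_opp.
      - apply path_continuous_mult; [trivial|apply path_continuous_const].
      - apply path_continuous_const. }
    split; [apply Hd|]. apply (continuous_opp (V := R_NormedModule)), Hd. }
assert (HN0 : forall s, s <> 0%R -> (0 <= Re (N s))%R).
{ intros s Hs. destruct (Hta s) as [H1 H2]. apply scaled_field_half_plane; trivial; try lra.
  - pose proof (Rsqr_pos_lt s Hs) as Hs2. unfold Rsqr in Hs2.
    split; [apply Hr|]. unfold r. rewrite <- Rinv_1 at 2.
    apply Rinv_lt_contravar; lra.
  - apply zero_map_fixed_iff; trivial. apply large_k_neq_0. }
assert (HE : N 0%R = scaled_field p k 1 z * Cconj ((z - tau) * (Cconj tau * z - 1))).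
{ unfold N. now rewrite Hr0, Hta0. }
rewrite <- HE.
(* A negative value at s = 0 would persist nearby, in particular at s = e/2 <> 0, where the sign is
   already known. *)
apply Rnot_lt_le. intros Hneg.
destruct (eps_of_path_continuous N 0 HN (- Re (N 0%R))%R ltac:(lra)) as [e [He0 H]].
specialize (H (e / 2)%R). rewrite Rminus_0_r, Rabs_pos_eq in H by lra.
specialize (H ltac:(lra)). specialize (HN0 (e / 2)%R ltac:(lra)).
pose proof (re_le_Cmod (N (e / 2)%R - N 0%R)) as H1.
change (Re (N (e / 2)%R - N 0%R)) with (Re (N (e / 2)%R) - Re (N 0%R))%R in H1.
rewrite Rabs_pos_eq in H1 by lra. lra.
Qed.

End Zero.

(** The half-plane inequality is empty at z = tau, where both of its factors vanish; the sign there
    is inherited from the points tau + m with m > 0 small. *)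
Lemma Re_nonneg_at_puncture h tau : C_differentiable h tau -> (Cmod tau < 1)%R ->
  (forall z, (Cmod z < 1)%R -> z <> tau -> (0 <= Re (h z))%R) -> (0 <= Re (h tau))%R.
Proof.
intros Hh Htau Hre. apply Rnot_lt_le. intros Hneg.
destruct (C_differentiable_continuous h tau Hh (- Re (h tau))%R ltac:(lra)) as [e [He0 He]].
set (m := (Rmin e (1 - Cmod tau) / 2)%R).
assert (Hm0 : (0 < Rmin e (1 - Cmod tau))%R) by (apply Rmin_pos; lra).
pose proof (Rmin_l e (1 - Cmod tau)) as Hm1. pose proof (Rmin_r e (1 - Cmod tau)) as Hm2.
assert (Hm : Cmod m = m) by (rewrite Cmod_R, Rabs_pos_eq; unfold m; lra).
assert (Hd : tau + m - tau = m) by ring.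
specialize (He (tau + m)). rewrite Hd, Hm in He. specialize (He ltac:(unfold m; lra)).
assert (H1 : (0 <= Re (h (tau + m)%C))%R).
{ apply Hre.
  - eapply Rle_lt_trans; [apply Cmod_triangle|]. rewrite Hm. unfold m. lra.
  - intros E. rewrite E in Hd. replace (tau - tau) with (RtoC 0) in Hd by ring.
    apply RtoC_inj in Hd. unfold m in Hd. lra. }
pose proof (re_le_Cmod (h (tau + m) - h tau)) as H2.
change (Re (h (tau + m) - h tau)) with (Re (h (tau + m)%C) - Re (h tau))%R in H2.
rewrite Rabs_pos_eq in H2 by lra. lra.
Qed.

Lemma rotated_field_scaled (p : C -> C) (k : R) z :
  rotated_field p k z = scaled_field p k 1 z.
Proof.
unfold rotated_field, scaled_field. rewrite (Cmult_1_l z). simpl. ring.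
Qed.

(** Removing the zero tau and dividing by conj tau z - 1 defines [p0] on the whole disc. Off tau its
    real part is the given nonnegative quantity divided by the positive number |(z - tau)(conj tau z
    - 1)|^2. *)
Lemma rotated_field_berkson_porta (p : C -> C) (k : R) tau :
  (forall z, (Cmod z < 1)%R -> C_differentiable p z) ->
  (Cmod tau < 1)%R -> rotated_field p k tau = 0 ->
  (forall z, (Cmod z < 1)%R ->
    (0 <= Re (rotated_field p k z * Cconj ((z - tau) * (Cconj tau * z - 1))))%R) ->
  exists p0, berkson_porta (rotated_field p k) tau p0.
Proof.
intros Hp Htau H0 Hre.
destruct (zero_factorisation (rotated_field p k) 1 tau) as [q Hq]; trivial.
{ intros z Hz. apply (C_differentiable_ext_loc (scaled_field p k 1) _ z 1); [lra| |].
  - intros y _. symmetry. apply rotated_field_scaled.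
  - apply scaled_field_differentiable. rewrite Cmult_1_l. now apply Hp. }
assert (Hne : forall z, (Cmod z < 1)%R -> Cconj tau * z - 1 <> 0).
{ intros z Hz. apply moebius_denominator; trivial.
  pose proof (Cmod_ge_0 z). pose proof (Cmod_ge_0 tau). nra. }
set (p0 := fun z => q z / (Cconj tau * z - 1)).
assert (Hp0 : forall z, (Cmod z < 1)%R -> C_differentiable p0 z).
{ intros z Hz. apply moebius_quotient_differentiable; [now apply Hq|now apply Hne]. }
assert (Hf : forall z, (Cmod z < 1)%R ->
  rotated_field p k z = (z - tau) * (Cconj tau * z - 1) * p0 z).
{ intros z Hz. rewrite (proj1 (Hq z Hz)). unfold p0. field. now apply Hne. }
assert (Hpunct : forall z, (Cmod z < 1)%R -> z <> tau -> (0 <= Re (p0 z))%R).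
{ intros z Hz Hzt. specialize (Hre z Hz). rewrite (Hf z Hz) in Hre.
  set (D := (z - tau) * (Cconj tau * z - 1)) in *.
  assert (HD : D <> 0).
  { apply Cmult_neq_0; [|now apply Hne]. intros E. apply Hzt.
    replace z with ((z - tau) + tau) by ring. rewrite E. ring. }
  apply Cmod_gt_0 in HD. apply (pow_lt _ 2) in HD.
  replace (D * p0 z * Cconj D) with (RtoC (Cmod D ^ 2) * p0 z) in Hre
    by (rewrite Cmod2_conj; ring).
  replace (Re _) with (Cmod D ^ 2 * Re (p0 z))%R in Hre by (unfold Re; simpl; ring).
  apply Rmult_le_reg_l with (Cmod D ^ 2)%R; trivial. now rewrite Rmult_0_r. }
exists p0. repeat split.
- lra.
- intros z Hz. destruct (Hp0 z Hz) as [l Hl]. now apply (ex_derive_of_C_diff p0 z l).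
- intros z Hz. destruct (classic (z = tau)) as [->|Hzt]; [|now apply Hpunct].
  apply Re_nonneg_at_puncture; trivial. now apply Hp0.
- intros z Hz. now apply Hf.
Qed.

Lemma rotated_field_small_zero (p : C -> C) (delta : R) :
  holomorphic_on_disk p -> (forall z, in_disk z -> (0 <= Re (p z))%R) -> (0 < delta)%R ->
  exists k0 : R, forall k : R, (k0 < Rabs k)%R ->
    exists tau, in_disk tau /\ (Cmod tau < delta)%R /\
      (exists z, in_disk z /\ rotated_field p k z <> 0) /\
      (exists p0, berkson_porta (rotated_field p k) tau p0).
Proof.
intros Hhol Hre Hdelta.
assert (Hp : forall z, (Cmod z < 1)%R -> C_differentiable p z).
{ intros z Hz. apply C_diff_of_ex_derive. now apply Hhol. }
destruct (locally_lipschitz_at_0 p 1 Rlt_0_1 Hp) as [L [HL Hlip]].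
(* Halving makes d < delta strict and yields d <= 1/8, which keeps the ball inside the disc of
   radius 1/4 where [p] is known to be Lipschitz. *)
set (d := (Rmin delta (1 / 4) / 2)%R).
assert (Hd : (0 < d <= 1 / 8)%R /\ (d < delta)%R).
{ assert (0 < Rmin delta (1 / 4))%R by (apply Rmin_pos; lra).
  pose proof (Rmin_l delta (1 / 4)). pose proof (Rmin_r delta (1 / 4)). unfold d. lra. }
destruct Hd as [Hd Hdd].
exists (4 * (3 * (Cmod (p 0%R) + L) + 2 * L + 1) / d)%R. intros k Hk.
destruct (scaled_field_zero p L d k HL Hlip Hd Hk 1 ltac:(lra)) as [tau [Htau Hfix]].
pose proof (large_k_neq_0 p L d k HL Hd Hk) as Hk0.
exists tau. repeat split.
- unfold in_disk. lra.
- lra.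
(* The field cannot vanish at both 0 and d: these would be two fixed points of a contraction, giving
   d <= d/2. *)
- destruct (classic (rotated_field p k 0 = 0)) as [E0|E0].
  2:{ exists 0. split; trivial. unfold in_disk. rewrite Cmod_0. lra. }
  assert (Hcd : Cmod d = d) by (rewrite Cmod_R, Rabs_pos_eq; lra).
  exists d. split; [unfold in_disk; lra|]. intros Ed.
  rewrite rotated_field_scaled in E0, Ed.
  apply zero_map_fixed_iff in E0; trivial. apply zero_map_fixed_iff in Ed; trivial.
  assert (H : (Cmod (zero_map p k 1 d - zero_map p k 1 0) <= / 2 * Cmod (d - 0))%R).
  { apply (zero_map_contraction p L d k HL Hlip Hd Hk); try lra. rewrite Cmod_0. lra. }
  rewrite E0, Ed in H. replace (d - 0) with (RtoC d) in H by ring. lra.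
- apply rotated_field_berkson_porta; trivial; try lra.
  + rewrite rotated_field_scaled. now apply zero_map_fixed_iff.
  + intros z Hz. rewrite rotated_field_scaled.
    now apply (scaled_field_half_plane_limit p L d k).
Qed.

Theorem proposition6 :
  forall p : C -> C,
    holomorphic_on_disk p ->
    (forall z, in_disk z -> (0 <= Re (p z))%R) ->
    (exists k0 : R, forall k : R, (k0 < Rabs k)%R ->
       forall psi : R -> C -> C,
         holomorphic_semigroup psi ->
         generated_by psi (rotated_field p k) ->
         elliptic psi) /\
    (forall delta : R, (0 < delta)%R ->
       exists k0 : R, forall k : R, (k0 < Rabs k)%R ->
       forall psi : R -> C -> C,
         holomorphic_semigroup psi ->
         generated_by psi (rotated_field p k) ->
         elliptic psi /\
         exists z0 : C,
           is_Denjoy_Wolff_point psi z0 /\ in_disk z0 /\ (Cmod z0 < delta)%R).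
Proof.
intros p Hp Hre.
assert (Hmain : forall delta : R, (0 < delta)%R ->
  exists k0 : R, forall k : R, (k0 < Rabs k)%R -> forall psi : R -> C -> C,
    generated_by psi (rotated_field p k) ->
    exists z0 : C, is_Denjoy_Wolff_point psi z0 /\ in_disk z0 /\ (Cmod z0 < delta)%R).
{ intros delta Hdelta.
  destruct (rotated_field_small_zero p delta Hp Hre Hdelta) as [k0 Hk0].
  exists k0. intros k Hk psi Hpsi.
  destruct (Hk0 k Hk) as [tau [Htau [Hsmall [Hnz Hbp]]]].
  exists tau. repeat split; trivial. now exists (rotated_field p k). }
split.
(* For ellipticity alone any positive delta serves. *)
- destruct (Hmain 1%R Rlt_0_1) as [k0 Hk0].
  exists k0. intros k Hk psi _ Hpsi.
  destruct (Hk0 k Hk psi Hpsi) as [tau [Htau [Hd _]]]. now exists tau.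
- intros delta Hdelta. destruct (Hmain delta Hdelta) as [k0 Hk0].
  exists k0. intros k Hk psi _ Hpsi.
  destruct (Hk0 k Hk psi Hpsi) as [tau [Htau [Hd Hs]]].
  split; [now exists tau|]. now exists tau.
Qed.
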